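(* Let $\mu$ and $\nu$ be strict partitions, and let $x=(x_1,x_2,\dots)$, $y=(y_1,y_2,\dots)$ be two sets of commuting variables. Then \[ \sum_\lambda GP_{\lambda/\!\!/\mu}(x)\,gq_{\lambda/\nu}(y)=\prod_{i,j\ge1}\frac{1-\overline{x_i}y_j}{1-x_iy_j}\sum_\kappa GP_{\nu/\!\!/\kappa}(x)\,gq_{\mu/\kappa}(y) \] and \[ \sum_\lambda GQ_{\lambda/\!\!/\mu}(x)\,gp_{\lambda/\nu}(y)=\prod_{i,j\ge1}\frac{1-\overline{x_i}y_j}{1-x_iy_j}\sum_\kappa GQ_{\nu/\!\!/\kappa}(x)\,gp_{\mu/\kappa}(y), \] where $\overline{x_i}:=\frac{-x_i}{1+\beta x_i}$ and $\lambda,\kappa$ range over all strict partitions.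
   Context: A strict partition is a finite strictly decreasing sequence of positive integers (possibly empty); $|\lambda|=\sum\lambda_i$. $\mathsf{SD}_\lambda=\{(i,j)\in\mathbb{Z}^2:0<i\le j<i+\lambda_i\}$; $\mu\subseteq\lambda$ means $\mu_i\le\lambda_i$ for all $i$, $\mathsf{SD}_{\lambda/\mu}=\mathsf{SD}_\lambda\setminus\mathsf{SD}_\mu$, $|\lambda/\mu|=|\mathsf{SD}_{\lambda/\mu}|$. Let $i'=i-\frac12$ ($1'<1<2'<2<\cdots$). A semistandard set-valued shifted tableau of shape $\lambda/\mu$ is a filling $T$ of $\mathsf{SD}_{\lambda/\mu}$ by nonempty finite sets of positive half-integers, weakly increasing along rows and columns ($S\le S'$ iff $\max S\le\min S'$), with no unprimed number in two boxes of one column and no primed number in two boxes of one row; $\mathrm{SetShYT}_Q(\lambda/\mu)$ is the set of these, $\mathrm{SetShYT}_P(\lambda/\mu)$ those with no primed number in a diagonal box $(j,j)$. $x^T=\prod x_i^{m_i}$ ($m_i$ = total occurrences of $i$ or $i'$), $|T|$ = total number of elements. $GP_{\lambda/\mu}=\sum_{T\in\mathrm{SetShYT}_P(\lambda/\mu)}\beta^{|T|-|\lambda/\mu|}x^T$, $GQ_{\lambda/\mu}$ likewise over $\mathrm{SetShYT}_Q$; both are $0$ if $\mu\not\subseteq\lambda$; $GP_\lambda=GP_{\lambda/\emptyset}$, $GQ_\lambda=GQ_{\lambda/\emptyset}$. $\mathsf{Rem}(\mu)$ is the set of boxes $b\in\mathsf{SD}_\mu$ with $\mathsf{SD}_\mu\setminus\{b\}$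 a shifted diagram of a strict partition; $GP_{\lambda/\!\!/\mu}=\sum_\nu\beta^{|\mu/\nu|}GP_{\lambda/\nu}$, $GQ_{\lambda/\!\!/\mu}=\sum_\nu\beta^{|\mu/\nu|}GQ_{\lambda/\nu}$ over strict $\nu\subseteq\mu$ with $\mathsf{SD}_{\mu/\nu}\subseteq\mathsf{Rem}(\mu)$, and both are $0$ if $\mu\not\subseteq\lambda$. The dual functions $gp_\lambda,gq_\lambda\in\mathbb{Z}[\beta][[x_1,x_2,\dots]]$ are the unique elements with $\sum_\lambda GQ_\lambda(x)gp_\lambda(y)=\sum_\lambda GP_\lambda(x)gq_\lambda(y)=\prod_{i,j}\frac{1-\overline{x_i}y_j}{1-x_iy_j}$. There are unique integers $a^\lambda_{\mu\nu},b^\lambda_{\mu\nu}$ with $GP_\mu GP_\nu=\sum_\lambda a^\lambda_{\mu\nu}\beta^{|\lambda|-|\mu|-|\nu|}GP_\lambda$ and $GQ_\mu GQ_\nu=\sum_\lambda b^\lambda_{\mu\nu}\beta^{|\lambda|-|\mu|-|\nu|}GQ_\lambda$; $gq_{\lambda/\mu}:=\sum_\nu a^\lambda_{\mu\nu}\beta^{|\lambda|-|\mu|-|\nu|}gq_\nu$, $gp_{\lambda/\mu}:=\sum_\nu b^\lambda_{\mu\nu}\beta^{|\lambda|-|\mu|-|\nu|}gp_\nu$. *)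

(* Defs.v *)
From HB Require Import structures.
From mathcomp Require Import all_boot all_order all_algebra.
From mathcomp Require Import finmap multiset.
From mathcomp Require Import boolp classical_sets functions cardinality fsbigop.

Set Implicit Arguments.
Unset Strict Implicit.
Unset Printing Implicit Defensive.

Import GRing.Theory.

Local Open Scope classical_set_scope.
Local Open Scope fset_scope.
Local Open Scope ring_scope.

Notation monom I := (multiset_of (Phant I)).

(* A series is the family of its coefficients, indexed by the monomials
   in the variables I, i.e. by the finite multisets of elements of I. *)
Definition fps (R : comNzRingType) (I : choiceType) := monom I -> R.

Definition msplit (I : choiceType) (m : monom I) : set (monom I * monom I) :=
  [set p | (p.1 `+` p.2)%mset = m].

HB.lock Definition fps_const (R : comNzRingType) (I : choiceType) (c : R) : fps R I :=
  fun m => if m == mset0 then c else 0.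

HB.lock Definition fps_var (R : comNzRingType) (I : choiceType) (i : I) : fps R I :=
  fun m => (m == [mset i]%mset)%:R.

HB.lock Definition fps_mul (R : comNzRingType) (I : choiceType) (f g : fps R I) :
  fps R I := fun m => \sum_(p \in msplit m) f p.1 * g p.2.

Section FpsRing.
Variables (R : comNzRingType) (I : choiceType).
Implicit Types (f g h : fps R I) (m : monom I).

HB.instance Definition _ := GRing.Zmodule.copy (fps R I) (monom I -> R).

Let divs m : {fset monom I} := fset_set [set a | (a `<=` m)%mset].

Let finite_divs m : finite_set [set a : monom I | (a `<=` m)%mset].
Proof.
pose n := (size m).+1.
pose F (t : {ffun finsupp m -> 'I_n}) : monom I :=
  [fsfun x : finsupp m => nat_of_ord (t x) | 0%N].
apply: (@sub_finite_set _ _ (F @` [set: {ffun finsupp m -> 'I_n}])); last first.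
  exact/finite_image/finite_finset.
move=> a /= /msubsetP am.
have lt x : (a x < n)%N.
  rewrite ltnS (leq_trans (am x))// -count_mem_mset.
  exact: count_size.
exists [ffun x => Ordinal (lt (val x))] => //.
apply/fsfunP => x; rewrite /F fsfun_ffun.
case: insubP => [u _ <-|xm] /=; first by rewrite ffunE.
by apply/esym/eqP; rewrite -leqn0 (leq_trans (am x)) // fsfun_dflt.
Qed.

Let in_divs m a : (a \in divs m) = (a `<=` m)%mset.
Proof. by rewrite /divs in_fset_set//; apply/idP/idP => /[!inE]. Qed.

Let divs_l a b : a \in divs (a `+` b)%mset.
Proof. by rewrite in_divs; apply/msubsetP => x; rewrite msetE2 leq_addr. Qed.

Let divs_r a b : b \in divs (a `+` b)%mset.
Proof. by rewrite in_divs; apply/msubsetP => x; rewrite msetE2 leq_addl. Qed.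

Let fps_mulE f g m (V : {fset monom I}) : {subset divs m <= V} ->
  fps_mul f g m =
  \sum_(a <- V) \sum_(b <- V) (if (a `+` b)%mset == m then f a * g b else 0).
Proof.
move=> sV; rewrite [fps_mul]unlock.
pose F a b : R := if (a `+` b)%mset == m then f a * g b else 0.
have -> : \sum_(p \in msplit m) f p.1 * g p.2 = \sum_(p \in msplit m) F p.1 p.2.
  by apply: eq_fsbigr => p; rewrite inE /msplit /= /F => ->; rewrite eqxx.
have -> : \sum_(a <- V) \sum_(b <- V) F a b =
    \sum_(a \in [set` V]) \sum_(b \in [set` V]) F a b.
  rewrite [LHS]fsbig_seq ?fset_uniq//; apply: eq_fsbigr => a _.
  by rewrite fsbig_seq ?fset_uniq.
have Vfin : finite_set [set` V] by exact: finite_fset.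
rewrite (pair_fsbig _ _ Vfin Vfin).
apply: fsbig_widen => [[p q] /= pm|p [_ /= /eqP/negbTE pm]]; last by rewrite /F pm.
have Vp : p \in V by apply: sV; rewrite -pm; exact: divs_l.
have Vq : q \in V by apply: sV; rewrite -pm; exact: divs_r.
by split.
Qed.

Let fps_mulC : commutative (@fps_mul R I).
Proof.
move=> f g; apply/funext => m.
rewrite !(@fps_mulE _ _ _ (divs m))// exchange_big/=.
by apply: eq_bigr => a _; apply: eq_bigr => b _; rewrite msetDC mulrC.
Qed.

Let fps_mulDl : left_distributive (@fps_mul R I) +%R.
Proof.
move=> f g h; apply/funext => m; rewrite !fctE !(@fps_mulE _ _ _ (divs m))//.
rewrite -big_split/=; apply: eq_bigr => a _; rewrite -big_split/=.
by apply: eq_bigr => b _; case: ifP => _; rewrite ?addr0 // mulrDl.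
Qed.

Let sum_delta (V : {fset monom I}) (c : monom I) (F : monom I -> R) :
  (c \notin V -> F c = 0) ->
  \sum_(a <- V) (if c == a then F a else 0) = F c.
Proof.
move=> Vc; have [cV|cV] := boolP (c \in V).
  rewrite (big_fsetD1 c)//= eqxx big_seq big1 ?addr0// => a.
  by rewrite !inE eq_sym => /andP[/negbTE ->].
rewrite Vc// big_seq big1// => a aV; case: eqP => // ca.
by rewrite ca aV in cV.
Qed.

Let fps_mul1 : left_id (@fps_const R I 1) (@fps_mul R I).
Proof.
move=> f; apply/funext => m; rewrite (@fps_mulE _ _ _ (divs m))//.
rewrite (eq_bigr (fun a : monom I => if mset0 == a then f m else 0)); last first.
  move=> a _; rewrite [fps_const]unlock eq_sym; case: eqP => [<-|_]; last first.
    by apply: big1 => b _; rewrite mul0r if_same.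
  rewrite -[RHS](@sum_delta (divs m)).
    by apply: eq_bigr => b _; rewrite mset0D eq_sym mul1r.
  by rewrite in_divs msubset_refl.
by apply: (@sum_delta (divs m) mset0 (fun=> f m)); rewrite in_divs msub0set.
Qed.

Let fps_mulA : associative (@fps_mul R I).
Proof.
suff H f g h m : fps_mul f (fps_mul g h) m = \sum_(a <- divs m)
    \sum_(b <- divs m) \sum_(d <- divs m)
      (if (a `+` (b `+` d))%mset == m then f a * (g b * h d) else 0).
  move=> f g h; apply/funext => m; rewrite [fps_mul (fps_mul f g) h]fps_mulC !H.
  rewrite [RHS]exchange_big; apply: eq_bigr => a _.
  rewrite [RHS]exchange_big; apply: eq_bigr => b _; apply: eq_bigr => d _ /=.
  by rewrite [(d `+` _)%mset]msetDC -msetDA mulrA [_ * h d]mulrC.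
rewrite (@fps_mulE _ _ _ (divs m))//; apply: eq_bigr => a _.
transitivity (\sum_(c <- divs m) \sum_(b <- divs m) \sum_(d <- divs m)
   (if (b `+` d)%mset == c then
      if (a `+` c)%mset == m then f a * (g b * h d) else 0 else 0)).
  rewrite big_seq [RHS]big_seq; apply: eq_bigr => c cm.
  rewrite (@fps_mulE _ _ _ (divs m)); last first.
    by move=> x; rewrite !in_divs in cm * => /msubset_trans; apply.
  case: ifP => _; last by rewrite big1// => b _; rewrite big1// => d _; rewrite if_same.
  rewrite mulr_sumr; apply: eq_bigr => b _; rewrite mulr_sumr; apply: eq_bigr => d _.
  by case: ifP; rewrite ?mulr0.
rewrite exchange_big; apply: eq_bigr => b _; rewrite exchange_big.
apply: eq_bigr => d _ /=.
rewrite (@sum_delta _ _ (fun c => if (a `+` c)%mset == m then f a * (g b * h d) else 0))//.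
by case: eqP => // <-; rewrite divs_r.
Qed.

Let fps_1neq0 : @fps_const R I 1 != 0.
Proof.
by apply/eqP => /(congr1 (@^~ mset0)); rewrite [fps_const]unlock eqxx => /eqP; rewrite oner_eq0.
Qed.

HB.instance Definition _ := GRing.Zmodule_isComNzRing.Build (fps R I)
  fps_mulA fps_mulC fps_mul1 fps_mulDl fps_1neq0.

End FpsRing.

(* Units and inverses, classically: f^-1 is the inverse of f if there is one,
   and f itself otherwise. *)
HB.lock Definition fps_unit (R : comNzRingType) (I : choiceType) (f : fps R I) : bool :=
  `[< exists g, g * f = 1 >].

HB.lock Definition fps_inv (R : comNzRingType) (I : choiceType) (f : fps R I) : fps R I :=
  if pselect (exists g, g * f = 1) is left e then projT1 (cid e) else f.

Section FpsUnitRing.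
Variables (R : comNzRingType) (I : choiceType).
Implicit Types (f g : fps R I) (m : monom I).

Let fps_mulV : {in @fps_unit R I, left_inverse 1 (@fps_inv R I) *%R}.
Proof.
move=> f; rewrite unfold_in unlock => /asboolP e.
rewrite [fps_inv]unlock; case: pselect => // e'.
exact: (projT2 (cid e')).
Qed.

Let fps_unitP f g : g * f = 1 -> fps_unit f.
Proof. by move=> gf; rewrite unlock; apply/asboolP; exists g. Qed.

Let fps_invout : {in [predC @fps_unit R I], @fps_inv R I =1 id}.
Proof.
move=> f; rewrite inE/= unfold_in [fps_unit]unlock [fps_inv]unlock => /negP nf.
by case: pselect => // e; case: nf; apply/asboolP.
Qed.

HB.instance Definition _ := GRing.ComNzRing_hasMulInverse.Build (fps R I)
  fps_mulV fps_unitP fps_invout.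

End FpsUnitRing.

Section FpsUnit.
Variables (R : comNzRingType) (I : choiceType).
Implicit Types (f g u : fps R I) (m : monom I).

Lemma coef_fps1 m : (1 : fps R I) m = (m == mset0)%:R.
Proof. by have -> : 1 = @fps_const R I 1 by []; rewrite unlock; case: eqP. Qed.

Lemma coef_fpsD f g m : (f + g) m = f m + g m.
Proof. by []. Qed.

Lemma coef_fpsN f m : (- f) m = - f m.
Proof. by []. Qed.

Lemma coef_fpsM f g m : (f * g) m = \sum_(p \in msplit m) f p.1 * g p.2.
Proof. by have -> : f * g = fps_mul f g by []; rewrite unlock. Qed.

Let size_msetD (a b : monom I) : size (a `+` b)%mset = (size a + size b)%N.
Proof.
have -> : (a `+` b)%mset = seq_mset (a ++ b).
  by apply/msetP => x; rewrite mset_seqE count_cat !count_mem_mset msetE2.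
by rewrite (perm_size (perm_eq_seq_mset _)) size_cat.
Qed.

Let coefX_small u k m : u mset0 = 0 -> (size m < k)%N -> (u ^+ k) m = 0.
Proof.
move=> u0; elim: k m => // k IH m mk; rewrite exprS coef_fpsM fsbig1// => p pm.
have [->|p0] := eqVneq p.1 mset0; first by rewrite u0 mul0r.
rewrite IH ?mulr0//; rewrite -pm size_msetD ltnS in mk.
by apply: leq_trans mk; rewrite -[ltnLHS]add0n ltn_add2r lt0n size_mset_eq0.
Qed.

Lemma fps_unit_coef0 f : f mset0 = 1 -> f \is a GRing.unit.
Proof.
move=> f0; pose u := 1 - f.
have u0 : u mset0 = 0.
  by rewrite /u coef_fpsD coef_fpsN coef_fps1 f0 eqxx subrr.
pose g : fps R I := fun m => (\sum_(k < (size m).+1) u ^+ k) m.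
have sumE (r : seq nat) m : (\sum_(k <- r) u ^+ k) m = \sum_(k <- r) (u ^+ k) m.
  by elim: r => [|k r IH]; rewrite ?big_nil// !big_cons coef_fpsD IH.
have gE m n : (size m <= n)%N -> g m = (\sum_(k < n.+1) u ^+ k) m.
  move=> mn; rewrite /g -!(big_mkord xpredT (fun k => u ^+ k)) !sumE.
  rewrite [in RHS](big_cat_nat _ (n := (size m).+1))//= [X in _ + X]big_nat_cond.
  by rewrite [X in _ + X]big1 ?addr0// => k /andP[/andP[mk _] _]; exact: coefX_small.
apply/unitrPr; exists g; apply/funext => m.
have -> : (f * g) m = (f * \sum_(k < (size m).+1) u ^+ k) m.
  rewrite !coef_fpsM; apply: eq_fsbigr => p; rewrite inE => pm.
  by rewrite -(@gE p.2)// -pm size_msetD leq_addl.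
have -> : f = 1 - u by rewrite /u opprB addrC subrK.
have := subrX1 u (size m).+1; rewrite -opprB -[u - 1]opprB mulNr => /oppr_inj <-.
by rewrite coef_fpsD coef_fpsN coefX_small ?subr0.
Qed.

End FpsUnit.

Section FpsLimits.
Variables (R : comNzRingType) (I : choiceType).

Definition fps_summable (J : choiceType) (A : set J) (F : J -> fps R I) :=
  forall m, finite_set [set j | A j /\ F j m != 0].

(* Only meaningful when the family is summable. *)
Definition fps_sum (J : choiceType) (A : set J) (F : J -> fps R I) : fps R I :=
  fun m => \sum_(j \in A) F j m.

(* Coefficientwise limit: each coefficient is eventually constant. *)
Definition fps_lim (u : nat -> fps R I) : fps R I :=
  fun m => xget 0 [set c | exists N, forall n, (N <= n)%N -> u n m = c].

(* Substitution of the variable h i for each variable i, for injective h. *)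
Definition fps_rename (J : choiceType) (h : I -> J) (f : fps R I) : fps R J :=
  fun m => \sum_(n \in [set n : monom I | seq_mset [seq h i | i <- n] = m]) f n.

End FpsLimits.

Record spart := Spart { parts : seq nat; _ : sorted gtn parts && (0 \notin parts)%N }.

HB.instance Definition _ := [isSub for parts].
HB.instance Definition _ := [Choice of spart by <:].

Definition spart0 : spart := @Spart [::] isT.

Definition psize (lam : spart) : nat := sumn (parts lam).

(* Parts are numbered from 1; the value at i = 0 is junk, equal to that at 1. *)
Definition part (lam : spart) (i : nat) : nat := nth 0%N (parts lam) i.-1.

Definition SD (lam : spart) : {fset nat * nat} :=
  [fset p in [seq (i, j) | i <- iota 1 (size (parts lam)), j <- iota i (part lam i)]].

Lemma in_SD lam i j : ((i, j) \in SD lam) = (0 < i <= j)%N && (j < i + part lam i)%N.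
Proof.
rewrite !inE /=; apply/allpairsPdep/idP => [[i' [j' [+ + [-> ->]]]]|].
  by rewrite !mem_iota => /andP[-> _].
case/andP => /andP[i0 ij] ji; exists i, j; rewrite !mem_iota i0 ij ji; split=> //.
rewrite add1n ltnS /=; case: leqP => // il; move: ji.
by rewrite /part nth_default ?addn0 ?ltnNge ?ij// -ltnS prednK.
Qed.

Definition psub (mu lam : spart) : Prop := forall i, (part mu i <= part lam i)%N.

Definition skewSD (lam mu : spart) : {fset nat * nat} := SD lam `\` SD mu.

Definition removable (mu : spart) (b : nat * nat) : Prop :=
  b \in SD mu /\ exists nu : spart, SD nu = SD mu `\ b.

(* The natural number k stands for the half-integer (k + 1) / 2, so that
   0, 1, 2, 3, ... are 1' < 1 < 2' < 2 < ...; the variables are numbered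
   from 0, so that k contributes the variable of index k./2. *)
Definition primed (k : nat) : bool := ~~ odd k.

Definition filling (lam mu : spart) := {ffun skewSD lam mu -> {fset nat}}.

Section Tableaux.
Variables lam mu : spart.
Implicit Types (T : filling lam mu) (b c : skewSD lam mu).

Definition row b : nat := (val b).1.
Definition col b : nat := (val b).2.

(* max S <= min S', for nonempty S and S' *)
Definition set_le (S S' : {fset nat}) : Prop :=
  forall k l, k \in S -> l \in S' -> (k <= l)%N.

Definition SetShYT_Q : set (filling lam mu) := [set T | [/\
  forall b, T b != fset0,
  forall b c, row b = row c -> (col b < col c)%N -> set_le (T b) (T c),
  forall b c, col b = col c -> (row b < row c)%N -> set_le (T b) (T c),
  forall b c k, b != c -> col b = col c -> k \in T b -> k \in T c -> primed k &
  forall b c k, b != c -> row b = row c -> k \in T b -> k \in T c -> ~~ primed k]].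

Definition SetShYT_P : set (filling lam mu) := [set T | SetShYT_Q T /\
  forall b k, row b = col b -> k \in T b -> ~~ primed k].

Definition tsize T : nat := (\sum_b #|` T b|)%N.

End Tableaux.

Notation Zbeta := {poly int}.

Definition beta {I : choiceType} : fps Zbeta I := fps_const 'X.

Definition xmon lam mu (T : filling lam mu) : fps Zbeta nat :=
  \prod_b \prod_(k <- T b) fps_var Zbeta k./2.

Definition tableau_gf (lam mu : spart) (A : set (filling lam mu)) : fps Zbeta nat :=
  if `[< psub mu lam >] then
    fps_sum A (fun T => beta ^+ (tsize T - #|` skewSD lam mu|) * xmon T)
  else 0.

Definition GPskew (lam mu : spart) := tableau_gf (@SetShYT_P lam mu).
Definition GQskew (lam mu : spart) := tableau_gf (@SetShYT_Q lam mu).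

Definition GP (lam : spart) := GPskew lam spart0.
Definition GQ (lam : spart) := GQskew lam spart0.

Definition dskew (G : spart -> spart -> fps Zbeta nat) (lam mu : spart) :
    fps Zbeta nat :=
  if `[< psub mu lam >] then
    fps_sum [set nu | psub nu mu /\ forall b, b \in skewSD mu nu -> removable mu b]
      (fun nu => beta ^+ #|` skewSD mu nu| * G lam nu)
  else 0.

Definition GPdskew := dskew GPskew.
Definition GQdskew := dskew GQskew.

(* Series in two alphabets: inl i is x_(i+1) and inr j is y_(j+1). *)
Notation fps_xy := (fps Zbeta (nat + nat)%type).

Definition in_x (f : fps Zbeta nat) : fps_xy := fps_rename inl f.
Definition in_y (f : fps Zbeta nat) : fps_xy := fps_rename inr f.

Definition xvar (i : nat) : fps_xy := fps_var Zbeta (inl i).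
Definition yvar (j : nat) : fps_xy := fps_var Zbeta (inr j).

Definition xbar (i : nat) : fps_xy := - xvar i / (1 + beta * xvar i).

Definition cauchy_factor (i j : nat) : fps_xy :=
  (1 - xbar i * yvar j) / (1 - xvar i * yvar j).

Definition cauchy_partial (n : nat) : fps_xy :=
  \prod_(i < n) \prod_(j < n) cauchy_factor i j.

Definition cauchy : fps_xy := fps_lim cauchy_partial.

Local Lemma factorE (S : comUnitRingType) (x y u : S) :
  1 - x * y \is a GRing.unit ->
  (1 - - x / u * y) / (1 - x * y) = 1 + x * y * ((1 + u^-1) / (1 - x * y)).
Proof.
move=> U; rewrite mulrA -[X in X + _ / _](divrr U) -mulrDl; congr (_ / _).
by rewrite mulrDr mulr1 addrA subrK !mulNr opprK mulrAC.
Qed.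

Local Lemma coef_var_mul (I : choiceType) (v : I) (f g : fps Zbeta I) (m : monom I) :
  v \notin m -> (f * (1 + fps_var Zbeta v * g)) m = f m.
Proof.
move=> vm; rewrite mulrDr mulr1 mulrCA coef_fpsD coef_fpsM fsbig1 ?addr0//.
move=> p pm; rewrite [fps_var]unlock; case: eqP => [pv|_]; last by rewrite mul0r.
by move: vm; rewrite -pm /= in_msetD pv in_mset1 eqxx.
Qed.

Local Lemma coef_prod_var (I : choiceType) (n : nat) (v : nat -> I)
    (f : fps Zbeta I) (F g : nat -> fps Zbeta I) (m : monom I) :
  (forall j, F j = 1 + fps_var Zbeta (v j) * g j) -> (forall j, v j \notin m) ->
  (f * \prod_(j < n) F j) m = f m.
Proof.
move=> FE vm; elim: n => [|n IH]; first by rewrite big_ord0 mulr1.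
by rewrite big_ord_recr mulrA FE coef_var_mul.
Qed.

Local Lemma cauchy_factorE i j : cauchy_factor i j = 1 + xvar i * yvar j *
  ((1 + (1 + beta * xvar i)^-1) / (1 - xvar i * yvar j)).
Proof.
have U : 1 - xvar i * yvar j \is a GRing.unit.
  apply: fps_unit_coef0; rewrite coef_fpsD coef_fpsN coef_fps1 eqxx coef_fpsM.
  rewrite fsbig1 ?subr0// => p /= pm.
  rewrite /xvar [fps_var]unlock; case: eqP => [p1|_]; last by rewrite mul0r.
  by move: (in_mset0 (inl i : (nat + nat)%type)); rewrite -pm in_msetD p1 in_mset1 eqxx.
exact: factorE U.
Qed.

Local Lemma cauchy_partialS n : cauchy_partial n.+1 =
  cauchy_partial n * (\prod_(i < n) cauchy_factor i n)
                   * \prod_(j < n.+1) cauchy_factor n j.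
Proof.
rewrite /cauchy_partial big_ord_recr/=; congr (_ * _).
rewrite -big_split/=; apply: eq_bigr => i _.
by rewrite big_ord_recr.
Qed.

Lemma cauchy_cvg m :
  exists N, forall n, (N <= n)%N -> cauchy_partial n m = cauchy m.
Proof.
pose idx (v : nat + nat) := match v with inl i => i | inr j => j end.
have [N Nm] : exists N, forall v, (N <= idx v)%N -> v \notin m.
  exists (\max_(v <- enum_mset m) idx v).+1 => v; apply: contraL => vm; rewrite -ltnNge ltnS.
  by rewrite (big_rem v vm)/= leq_maxl.
have stab n : (N <= n)%N -> cauchy_partial n m = cauchy_partial N m.
  move=> Nn; rewrite -(subnKC Nn); elim: (n - N)%N => [|k IH]; first by rewrite addn0.
  rewrite addnS -IH; move: (leq_addr k N); move: (N + k)%N => l Nl.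
  rewrite cauchy_partialS (@coef_prod_var _ _ (fun=> inl l) _ _ (fun j => yvar j *
     ((1 + (1 + beta * xvar l)^-1) / (1 - xvar l * yvar j)))).
  - apply: (@coef_prod_var _ _ (fun=> inr l) _ (cauchy_factor^~ l) (fun i => xvar i *
      ((1 + (1 + beta * xvar i)^-1) / (1 - xvar i * yvar l)))).
    + by move=> i; rewrite cauchy_factorE -mulrA mulrCA.
    + by move=> i; exact: Nm.
  - by move=> j; rewrite cauchy_factorE -mulrA.
  - by move=> j; exact: Nm.
have [M ME] : [set c | exists N, forall n, (N <= n)%N -> cauchy_partial n m = c]
    (cauchy m).
  by apply: xgetPex; exists (cauchy_partial N m), N.
by exists M.
Qed.

(* The series G lam are linearly independent, so this determines g. *)
Definition is_dual (G g : spart -> fps Zbeta nat) : Prop :=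
  fps_summable [set: spart] (fun lam => in_x (G lam) * in_y (g lam)) /\
  fps_sum [set: spart] (fun lam => in_x (G lam) * in_y (g lam)) = cauchy.

(* The product c^lam_(mu nu) beta^(|lam| - |mu| - |nu|); the subtraction is
   truncated, see the first clause of is_structure_constants. *)
Definition bcoef (c : spart -> spart -> spart -> int) (lam mu nu : spart) :
    fps Zbeta nat :=
  (c lam mu nu)%:~R * beta ^+ (psize lam - psize mu - psize nu).

(* The series G lam being linearly independent, this determines c; the first
   clause says that no negative power of beta occurs. *)
Definition is_structure_constants (G : spart -> fps Zbeta nat)
    (c : spart -> spart -> spart -> int) : Prop :=
  (forall lam mu nu, (psize lam < psize mu + psize nu)%N -> c lam mu nu = 0) /\
  forall mu nu,
    fps_summable [set: spart] (fun lam => bcoef c lam mu nu * G lam) /\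
    G mu * G nu = fps_sum [set: spart] (fun lam => bcoef c lam mu nu * G lam).

Definition dual_skew (c : spart -> spart -> spart -> int)
    (g : spart -> fps Zbeta nat) (lam mu : spart) : fps Zbeta nat :=
  fps_sum [set: spart] (fun nu => bcoef c lam mu nu * g nu).

(* Main.v *)
Require Import Defs.
From HB Require Import structures.
From mathcomp Require Import all_boot all_order all_algebra.
From mathcomp Require Import finmap multiset.
From mathcomp Require Import boolp classical_sets functions cardinality fsbigop.
From mathcomp Require Import zify ring.

Set Implicit Arguments.
Unset Strict Implicit.
Unset Printing Implicit Defensive.

Import GRing.Theory.

Local Open Scope classical_set_scope.
Local Open Scope ring_scope.

(** Write K for the Cauchy kernel and G for GP or GQ.  The definitions of the dual
    family and of the structure constants give
      sum_lam G_lam(x) g_(lam/nu)(y) = G_nu(x) K(x, y).                          (1)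
    Substitute for x a concatenated alphabet z_1, ..., z_n, x_1, x_2, ...; no
    symmetry of G is needed, since this only renumbers the variables.  Cutting a
    set-valued tableau of shape lam at the value n gives
      G_lam(z, x) = sum_mu G_mu(z) G_(lam//mu)(x):
    mu collects the boxes with a z-entry, and the boxes having both kinds of
    entries are removable boxes of mu.  As K(z, x; y) = K(z, y) K(x, y), both sides
    of (1) become combinations of the G_mu(z), the right-hand side after a second
    use of (1).  Letting n grow, linear independence of the G_mu allows one to
    compare the coefficients of G_mu(z), which are the two sides of the theorem. *)

(** * Multisets and coefficients of series *)

(** No series in the alphabet z, x is formed: a monomial z^m1 x^m2 is encoded as [m1] joined with
    [m2] shifted by n, and instead of a limit in n, the cut is chosen after [m1], beyond all its
    variables. Every identity is proved on coefficients, where the degree bound |lam| <= deg + |mu|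
    for the nonzero coefficients of G_(lam/mu) makes each sum over partitions finite. The double
    slash reflects set-valuedness. Cutting at n leaves a small part of shape mu and a large part of
    shape lam/nu, which overlap in mu/nu because a box may have entries on both sides of the cut.
    Counting these boxes twice costs beta^|mu/nu|. By monotonicity no other box of mu lies weakly
    southeast of a box with a large entry, so the overlap consists of removable boxes; conversely,
    removability is what lets the two parts be glued. Independence uses the shifted shape: an entry
    of row i has absolute value at least i, so the coefficients of the G_lam at the monomials x^mu
    are triangular for the statistic sum_i i mu_i. *)

Section Multisets.
Variable I : choiceType.
Implicit Types (a b m : monom I).

Lemma seq_mset_cons (x : I) s : seq_mset (x :: s) = ([mset x] `+` seq_mset s)%mset.
Proof. by apply/msetP => y; rewrite mset_seqE mset1DE mset_seqE /= eq_sym. Qed.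

Lemma msetDI a b c : (a `+` b = a `+` c -> b = c)%mset.
Proof.
move/msetP => E; apply/msetP => x; move: (E x); rewrite !msetE2; exact: addnI.
Qed.

Lemma size_mset_add a b : size (a `+` b)%mset = (size a + size b)%N.
Proof.
have -> : (a `+` b)%mset = seq_mset (a ++ b).
  by apply/msetP => x; rewrite mset_seqE count_cat !count_mem_mset msetE2.
by rewrite (perm_size (perm_eq_seq_mset _)) size_cat.
Qed.

(** Induction on the elements of [m]: taking one copy of [x] away from a side that contains it
    leaves a splitting of the remaining elements. *)
Lemma finite_msplit m : finite_set (msplit m).
Proof.
rewrite -(seq_mset_id m); elim: (enum_mset m) => [|x s IH].
  apply: (@sub_finite_set _ _ [set (mset0, mset0)]); last exact: finite_set1.
  move=> [a b] /= /msetP E; congr (_, _); apply/msetP => y; move: (E y);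
    by rewrite mset_seqE /= mset0E msetE2; lia.
pose l (p : monom I * monom I) := ((x +` p.1)%mset, p.2).
pose r (p : monom I * monom I) := (p.1, (x +` p.2)%mset).
apply: (@sub_finite_set _ _ ((l @` msplit (seq_mset s)) `|` (r @` msplit (seq_mset s)))).
  move=> [a b] /=; rewrite /msplit /= seq_mset_cons => E.
  have /orP[xa|xb] : (x \in a) || (x \in b) by rewrite -in_msetD E mset1D1.
  - left; exists ((a `\ x)%mset, b); rewrite /l /= ?msetB1K//.
    by apply: (@msetDI [mset x]%mset); rewrite msetDA msetB1K.
  - right; exists (a, (b `\ x)%mset); rewrite /r /= ?msetB1K//.
    by apply: (@msetDI [mset x]%mset); rewrite msetDCA msetB1K.
by rewrite finite_setU; split; exact: finite_image.
Qed.

Definition splits m : seq (monom I * monom I) := fset_set (msplit m).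

Lemma splits_uniq m : uniq (splits m).
Proof. exact: fset_uniq. Qed.

Lemma mem_splits m (p : monom I * monom I) : (p \in splits m) = ((p.1 `+` p.2)%mset == m).
Proof.
have := in_fset_set (finite_msplit m) p; rewrite /splits => ->.
by apply/idP/eqP; rewrite inE.
Qed.

Lemma splits_size m (p : monom I * monom I) : p \in splits m ->
  (size p.1 <= size m)%N /\ (size p.2 <= size m)%N.
Proof. by rewrite mem_splits => /eqP <-; rewrite size_mset_add; lia. Qed.

(** Serves twice: to separate x from y, and z from the shifted x. *)
Lemma splits_disjoint (R : nmodType) a b (F : monom I -> monom I -> R) :
  (forall x, x \in a -> x \notin b) ->
  \sum_(p <- splits (a `+` b)%mset) F p.1 p.2 =
  \sum_(p <- splits a) \sum_(q <- splits b) F (p.1 `+` q.1)%mset (p.2 `+` q.2)%mset.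
Proof.
move=> dab.
pose f (p q : monom I * monom I) := ((p.1 `+` q.1)%mset, (p.2 `+` q.2)%mset).
rewrite -(@big_allpairs_dep _ _ _ _ _ _ f _ _ (fun p => F p.1 p.2)).
apply: perm_big; apply: uniq_perm; first exact: splits_uniq.
  apply: allpairs_uniq; rewrite ?splits_uniq// => -[p q] [p' q'].
  move=> /allpairsP[[u v] [+ + [-> ->]]] /allpairsP[[u' v'] [+ + [-> ->]]].
  rewrite !mem_splits /f /= => /eqP/msetP E1 /eqP/msetP E2 /eqP/msetP E3 /eqP/msetP E4.
  move=> [/msetP E5 /msetP E6].
  have H x : [/\ u.1 x = u'.1 x, u.2 x = u'.2 x, v.1 x = v'.1 x & v.2 x = v'.2 x].
    move: (E1 x) (E2 x) (E3 x) (E4 x) (E5 x) (E6 x); rewrite !msetE2.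
    (* At each [x] one of the multiplicities [c] in [a] and [d] in [b] vanishes, which determines
       all the summands. *)
    have aux (c d u1 u2 v1 v2 u1' u2' v1' v2' : nat) : c = 0%N \/ d = 0%N ->
        (u1 + u2 = c -> v1 + v2 = d -> u1' + u2' = c -> v1' + v2' = d ->
         u1 + v1 = u1' + v1' -> u2 + v2 = u2' + v2' ->
         [/\ u1 = u1', u2 = u2', v1 = v1' & v2 = v2'])%N by split; lia.
    apply: aux; have [/dab|] := boolP (x \in a); rewrite -mset_eq0 => /eqP ->;
      by [left|right].
  congr ((_, _)); rewrite [LHS]surjective_pairing [RHS]surjective_pairing;
    by congr (_, _); apply/msetP => x; case: (H x).
move=> [p q]; rewrite mem_splits /=; apply/eqP/allpairsP => [E|[[u v] /= []]]; last first.
  by rewrite !mem_splits => /eqP <- /eqP <- [-> ->]; rewrite /= msetDACA.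
(* Intersection takes minima of multiplicities; as the supports are disjoint, it cuts [p] down to
   its restriction to the support of [a] or of [b]. *)
exists (((p `&` a)%mset, (q `&` a)%mset), ((p `&` b)%mset, (q `&` b)%mset)) => /=.
have H x : (p x + q x)%N = (a x + b x)%N /\ (a x = 0%N \/ b x = 0%N).
  move/msetP: E => /(_ x); rewrite !msetE2 => ->; split=> //.
  by have [/dab|] := boolP (x \in a); rewrite -mset_eq0 => /eqP ->; [right|left].
rewrite !mem_splits /f /=; split; [apply/eqP|apply/eqP|congr (_, _)];
  by apply/msetP => x; rewrite !msetE2; case: (H x); lia.
Qed.

End Multisets.

(** * Injective renamings of variables *)

Section MsetMap.
Variables (I J : choiceType) (h : I -> J).
Hypothesis h_inj : injective h.

Definition mmap (m : monom I) : monom J := seq_mset [seq h i | i <- m].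

Lemma mmapE m x : mmap m (h x) = m x.
Proof.
rewrite mset_seqE count_map -count_mem_mset; apply: eq_count => y /=.
by rewrite (inj_eq h_inj).
Qed.

Lemma mmapN m y : (forall x, h x <> y) -> mmap m y = 0%N.
Proof.
move=> H; rewrite mset_seqE; apply/count_memPn/mapP => -[x _ E].
exact: (H x).
Qed.

Lemma mmapP y : (exists x, y = h x) \/ (forall x, h x <> y).
Proof.
have [[x E]|H] := pselect (exists x, y = h x); first by left; exists x.
by right => x E; apply: H; exists x.
Qed.

Lemma size_mmap m : size (mmap m) = size m.
Proof. by rewrite (perm_size (perm_eq_seq_mset _)) size_map. Qed.

Lemma mmap_inj : injective mmap.
Proof. by move=> a b /msetP E; apply/msetP => x; rewrite -!mmapE E. Qed.

Lemma mmapD a b : (mmap (a `+` b) = mmap a `+` mmap b)%mset.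
Proof.
apply/msetP => y; rewrite msetE2; case: (mmapP y) => [[x ->]|H].
  by rewrite !mmapE msetE2.
by rewrite !mmapN.
Qed.

Lemma mmap0 : mmap mset0 = mset0.
Proof. by apply/msetP => y; rewrite mset_seqE enum_mset0 mset0E. Qed.

Lemma mmap1 x : mmap [mset x]%mset = [mset h x]%mset.
Proof.
apply/msetP => y; case: (mmapP y) => [[z ->]|H].
  by rewrite mmapE !msetnE (inj_eq h_inj).
by rewrite mmapN// msetnE; case: eqP => // E; case: (H x).
Qed.

Lemma mmap_surj a (p : monom J) : (p `<=` mmap a)%mset -> exists b, p = mmap b.
Proof.
move=> /msubsetP pa.
pose b : monom I := [fsfun x in finsupp a => p (h x) | 0%N].
exists b; apply/msetP => y; case: (mmapP y) => [[x ->]|N]; last first.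
  by have := pa y; rewrite !mmapN// leqn0 => /eqP.
rewrite mmapE fsfunE; case: ifPn => // xa; apply/eqP.
by rewrite -leqn0 (leq_trans (pa _))// mmapE leqn0 mset_eq0 -msuppE.
Qed.

Lemma splits_mmap (R : nmodType) m (F : monom J -> monom J -> R) :
  \sum_(p <- splits (mmap m)) F p.1 p.2 =
  \sum_(p <- splits m) F (mmap p.1) (mmap p.2).
Proof.
pose f (p : monom I * monom I) := (mmap p.1, mmap p.2).
rewrite -[RHS](big_map f xpredT (fun p => F p.1 p.2)).
apply: perm_big; apply: uniq_perm; first exact: splits_uniq.
  rewrite map_inj_uniq ?splits_uniq// => -[a b] [c d] [].
  by move/mmap_inj -> => /mmap_inj ->.
move=> [p q]; rewrite mem_splits /=; apply/eqP/mapP => [E|[[u v]]]; last first.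
  by rewrite mem_splits => /eqP /= <- [-> ->]; rewrite mmapD.
have [a Ea] : exists a, p = mmap a.
  by apply: (@mmap_surj m); apply/msubsetP => x; rewrite -E msetE2 leq_addr.
have [b Eb] : exists b, q = mmap b.
  by apply: (@mmap_surj m); apply/msubsetP => x; rewrite -E msetE2 leq_addl.
exists (a, b); rewrite /f /= ?Ea ?Eb// mem_splits /=.
by apply/eqP/mmap_inj; rewrite mmapD -Ea -Eb.
Qed.

End MsetMap.

Section Coefficients.
Variables (R : comNzRingType) (I : choiceType).
Implicit Types (f g : fps R I) (m : monom I).

Lemma coef_splits f g m : (f * g) m = \sum_(p <- splits m) f p.1 * g p.2.
Proof. by rewrite coef_fpsM fsbig_finite //; exact: finite_msplit. Qed.

Lemma coef_fps0 m : (0 : fps R I) m = 0.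
Proof. by []. Qed.

Lemma coef_constM (c : R) f m : (fps_const c * f) m = c * f m.
Proof.
rewrite coef_splits [fps_const]unlock (bigD1_seq (mset0, m)) ?splits_uniq//=; last first.
  by rewrite mem_splits /= mset0D.
rewrite eqxx big_seq_cond big1 ?addr0// => -[a b] /=; rewrite mem_splits /= => /andP[/eqP E n].
case: eqP => [a0|]; last by rewrite mul0r.
by move: n; rewrite a0 mset0D in E *; rewrite E eqxx.
Qed.

Lemma coef_constXM (c : R) n f m : (fps_const c ^+ n * f) m = c ^+ n * f m.
Proof.
elim: n f => [|n IH] f; first by rewrite !expr0 !mul1r.
by rewrite !exprS -!mulrA coef_constM IH.
Qed.

Lemma coef_intM (z : int) f m : (z%:~R * f) m = z%:~R * f m.
Proof.
have addM (n : nat) : (f *+ n) m = f m *+ n.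
  by elim: n => // n IH; rewrite !mulrS coef_fpsD IH.
rewrite mulrzl [RHS]mulrzl; case: z => n; first exact: addM.
by rewrite !NegzE !mulrNz coef_fpsN; congr (- _); exact: addM.
Qed.

End Coefficients.

(** * Multiplicativity of the Cauchy kernel *)

Section Pull.
Variables (R : comNzRingType) (I J : choiceType) (h : I -> J).

(* Sends the variable h i to i and kills the variables outside the image of h. *)
Definition fps_pull (_ : injective h) (f : fps R J) : fps R I := fun m => f (mmap h m).

Variable h_inj : injective h.

Lemma fps_pull_is_zmod_morphism : zmod_morphism (fps_pull h_inj).
Proof. by []. Qed.

Lemma fps_pull_is_monoid_morphism : monoid_morphism (fps_pull h_inj).
Proof.
split=> [|f g]; apply/funext => m; rewrite /fps_pull.
  by rewrite !coef_fps1 -(mmap0 h) (inj_eq (mmap_inj h_inj)).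
by rewrite !coef_splits (splits_mmap h_inj _ (fun p q => f p * g q)).
Qed.

HB.instance Definition _ := GRing.isZmodMorphism.Build _ _ (fps_pull h_inj)
  fps_pull_is_zmod_morphism.
HB.instance Definition _ := GRing.isMonoidMorphism.Build _ _ (fps_pull h_inj)
  fps_pull_is_monoid_morphism.

Lemma fps_pull_const c : fps_pull h_inj (fps_const c) = fps_const c.
Proof.
apply/funext => m; rewrite /fps_pull [fps_const]unlock.
by rewrite -{1}(mmap0 h) (inj_eq (mmap_inj h_inj)).
Qed.

Lemma fps_pull_var i : fps_pull h_inj (fps_var R (h i)) = fps_var R i.
Proof.
apply/funext => m; rewrite /fps_pull [fps_var]unlock.
by rewrite -(mmap1 h_inj) (inj_eq (mmap_inj h_inj)).
Qed.

End Pull.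

Section Restriction.
Variables (R : comNzRingType) (I : choiceType) (S : pred I).

(** The substitution of 0 for the variables outside [S]. *)
Definition fps_res (f : fps R I) : fps R I := fun m => if all S m then f m else 0.

Lemma all_msetD (a b : monom I) : all S (a `+` b)%mset = all S a && all S b.
Proof.
apply/allP/andP => [H|[/allP Ha /allP Hb] x]; last by rewrite in_msetD => /orP[/Ha|/Hb].
by split; apply/allP => x xa; apply: H; rewrite in_msetD xa ?orbT.
Qed.

Lemma fps_res_is_zmod_morphism : zmod_morphism fps_res.
Proof.
move=> f g; apply/funext => m; rewrite coef_fpsD coef_fpsN /fps_res.
by case: ifP; rewrite ?subr0.
Qed.

Lemma fps_res_is_monoid_morphism : monoid_morphism fps_res.
Proof.
split=> [|f g]; apply/funext => m; rewrite /fps_res.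
  by rewrite coef_fps1; case: eqP => [->|]; rewrite ?enum_mset0 //=; case: ifP.
rewrite !coef_splits; case: ifPn => Sm.
  rewrite big_seq [RHS]big_seq; apply: eq_bigr => p; rewrite mem_splits => /eqP E.
  by move: Sm; rewrite -E all_msetD => /andP[-> ->].
rewrite big_seq big1// => -[p q]; rewrite mem_splits /= => /eqP E.
move: Sm; rewrite -E all_msetD negb_and => /orP[/negbTE ->|/negbTE ->]; by rewrite ?mulr0 ?mul0r.
Qed.

HB.instance Definition _ := GRing.isZmodMorphism.Build _ _ fps_res
  fps_res_is_zmod_morphism.
HB.instance Definition _ := GRing.isMonoidMorphism.Build _ _ fps_res
  fps_res_is_monoid_morphism.

Lemma fps_res_const c : fps_res (fps_const c) = fps_const c.
Proof.
apply/funext => m; rewrite /fps_res [fps_const]unlock.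
by case: eqP => [->|]; rewrite ?enum_mset0//; case: ifP.
Qed.

Lemma fps_res_var i : fps_res (fps_var R i) = if S i then fps_var R i else 0.
Proof.
apply/funext => m; rewrite /fps_res [fps_var]unlock.
case: eqP => [->|]; first by rewrite enum_msetn /= andbT; case: ifP => //; rewrite eqxx.
by move/eqP/negbTE => E; rewrite if_same; case: ifP; rewrite ?E.
Qed.

End Restriction.

(** * Monomials and coefficients in two alphabets *)

Section TwoAlphabets.

(** The monomial x^m y^k. *)
Definition pairm (m k : monom nat) : monom (nat + nat)%type :=
  (mmap inl m `+` mmap inr k)%mset.

Lemma pairm_l m k i : pairm m k (inl i) = m i.
Proof. by rewrite msetE2 mmapE ?[mmap inr _ _]mmapN ?addn0//; exact: inl_inj. Qed.

Lemma pairm_r m k i : pairm m k (inr i) = k i.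
Proof. by rewrite msetE2 mmapE ?[mmap inl _ _]mmapN//; exact: inr_inj. Qed.

Lemma pairm_surj M : exists m k, M = pairm m k.
Proof.
pose l (v : nat + nat) := if v is inl i then Some i else None.
pose r (v : nat + nat) := if v is inr i then Some i else None.
exists (seq_mset (pmap l M)), (seq_mset (pmap r M)); apply/msetP => -[i|i];
  rewrite (pairm_l, pairm_r) mset_seqE -count_mem_mset;
  by elim: (enum_mset M) => // -[j|j] s IH /=; rewrite IH.
Qed.

Lemma pairm_inj m k m' k' : pairm m k = pairm m' k' -> m = m' /\ k = k'.
Proof.
move=> /msetP E; split; apply/msetP => i.
  by rewrite -(pairm_l m k) E pairm_l.
by rewrite -(pairm_r m k) E pairm_r.
Qed.

Lemma splits_pairm (A : nmodType) m k (F : _ -> _ -> A) :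
  \sum_(p <- splits (pairm m k)) F p.1 p.2 =
  \sum_(p <- splits m) \sum_(q <- splits k) F (pairm p.1 q.1) (pairm p.2 q.2).
Proof.
rewrite splits_disjoint.
  rewrite (splits_mmap inl_inj _ (fun a b => \sum_(q <- splits (mmap inr k))
      F (a `+` q.1)%mset (b `+` q.2)%mset)).
  apply: eq_bigr => p _.
  exact: (splits_mmap inr_inj _ (fun a b => F (_ `+` a)%mset (_ `+` b)%mset)).
move=> [i|i]; last by rewrite -mset_neq0 mmapN.
by rewrite -mset_eq0 [mmap inr _ _]mmapN.
Qed.

Lemma sum_splits0r (I : choiceType) (A : nmodType) (m : monom I) (F : _ -> _ -> A) :
  (forall a b, (a `+` b)%mset = m -> b != mset0 -> F a b = 0) ->
  \sum_(p <- splits m) F p.1 p.2 = F m mset0.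
Proof.
move=> F0; rewrite (bigD1_seq (m, mset0)) ?splits_uniq//=; last by rewrite mem_splits /= msetD0.
rewrite big_seq_cond big1 ?addr0// => -[a b] /=; rewrite mem_splits /= => /andP[/eqP E n].
by apply: F0 => //; apply: contraNneq n => b0; rewrite -E b0 msetD0.
Qed.

Lemma sum_splits0l (I : choiceType) (A : nmodType) (m : monom I) (F : _ -> _ -> A) :
  (forall a b, (a `+` b)%mset = m -> a != mset0 -> F a b = 0) ->
  \sum_(p <- splits m) F p.1 p.2 = F mset0 m.
Proof.
move=> F0; rewrite (bigD1_seq (mset0, m)) ?splits_uniq//=; last by rewrite mem_splits /= mset0D.
rewrite big_seq_cond big1 ?addr0// => -[a b] /=; rewrite mem_splits /= => /andP[/eqP E n].
by apply: F0 => //; apply: contraNneq n => a0; rewrite -E a0 mset0D.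
Qed.

Lemma in_xE f m k : in_x f (pairm m k) = if k == mset0 then f m else 0.
Proof.
rewrite /in_x /fps_rename; case: eqP => [->|k0].
  transitivity (\sum_(y \in [set m]) f y); last by rewrite fsbig_set1.
  apply: eq_fsbigl; apply/seteqP; split=> n /=.
    by rewrite -/(mmap inl n) /pairm mmap0 msetD0 => /(mmap_inj inl_inj).
  by move=> ->; rewrite -/(mmap inl m) /pairm mmap0 msetD0.
apply: fsbig1 => n /=; rewrite -/(mmap inl n) -[mmap inl n]msetD0 -(mmap0 inr).
by case/pairm_inj => _ /esym.
Qed.

Lemma in_yE f m k : in_y f (pairm m k) = if m == mset0 then f k else 0.
Proof.
rewrite /in_y /fps_rename; case: eqP => [->|k0].
  transitivity (\sum_(y \in [set k]) f y); last by rewrite fsbig_set1.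
  apply: eq_fsbigl; apply/seteqP; split=> n /=.
    by rewrite -/(mmap inr n) /pairm mmap0 mset0D => /(mmap_inj inr_inj).
  by move=> ->; rewrite -/(mmap inr k) /pairm mmap0 mset0D.
apply: fsbig1 => n /=; rewrite -/(mmap inr n) -[mmap inr n]mset0D -(mmap0 inl).
by case/pairm_inj => /esym.
Qed.

Lemma coef_xy f g m k : (in_x f * in_y g) (pairm m k) = f m * g k.
Proof.
rewrite coef_splits (splits_pairm _ _ (fun a b => in_x f a * in_y g b)).
rewrite (sum_splits0r (F := fun a b => \sum_(q <- splits k)
    in_x f (pairm a q.1) * in_y g (pairm b q.2))); last first.
  by move=> a b _ /negbTE b0; rewrite big1// => q _; rewrite in_yE b0 mulr0.
rewrite (sum_splits0l (F := fun a b => in_x f (pairm m a) * in_y g (pairm mset0 b))).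
  by rewrite in_xE in_yE !eqxx.
by move=> a b _ /negbTE a0; rewrite in_xE a0 mul0r.
Qed.

Lemma all_pairm (S : pred (nat + nat)%type) m k :
  all S (pairm m k) = all (fun i => S (inl i)) m && all (fun i => S (inr i)) k.
Proof. by rewrite all_msetD !(perm_all _ (perm_eq_seq_mset _)) !all_map. Qed.

End TwoAlphabets.

Lemma coef_varM0 (I : choiceType) (v : I) (f : fps Zbeta I) : (fps_var Zbeta v * f) mset0 = 0.
Proof.
rewrite coef_splits big_seq big1// => -[a b]; rewrite mem_splits /= [fps_var]unlock.
move=> /eqP E; case: eqP => [a1|]; last by rewrite mul0r.
by move: (in_mset0 v); rewrite -E a1 in_msetD in_mset1 eqxx.
Qed.

Lemma unit_1Bxy i j : 1 - xvar i * yvar j \is a GRing.unit.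
Proof.
by apply: fps_unit_coef0; rewrite coef_fpsD coef_fpsN coef_varM0 coef_fps1 eqxx subr0.
Qed.

Lemma unit_1Dbx i : 1 + beta * xvar i \is a GRing.unit.
Proof.
by apply: fps_unit_coef0; rewrite coef_fpsD mulrC coef_varM0 coef_fps1 eqxx addr0.
Qed.

Section FactorMorphism.
Variable phi : {rmorphism fps Zbeta (nat + nat)%type -> fps Zbeta (nat + nat)%type}.
Hypothesis phi_beta : phi beta = beta.

Let morph_factorE i j : phi (cauchy_factor i j) =
  (1 - - phi (xvar i) / (1 + beta * phi (xvar i)) * phi (yvar j)) /
  (1 - phi (xvar i) * phi (yvar j)).
Proof.
have phi_xbar : phi (xbar i) = - phi (xvar i) / (1 + beta * phi (xvar i)).
  by rewrite /xbar rmorph_div ?unit_1Dbx// rmorphN rmorphD rmorphM rmorph1 phi_beta.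
rewrite /cauchy_factor rmorph_div ?unit_1Bxy// !rmorphB rmorph1.
by rewrite [phi (xbar i * _)]rmorphM phi_xbar rmorphM.
Qed.

(** A factor is built from [beta] and two variables by ring operations and inverses of units, all of
    which a ring morphism respects. *)
Lemma cauchy_factor_morph i j i' j' : phi (xvar i) = xvar i' -> phi (yvar j) = yvar j' ->
  phi (cauchy_factor i j) = cauchy_factor i' j'.
Proof. by rewrite morph_factorE => -> ->. Qed.

Lemma cauchy_factor_morph1 i j : phi (xvar i) = 0 \/ phi (yvar j) = 0 ->
  phi (cauchy_factor i j) = 1.
Proof.
by rewrite morph_factorE => -[] ->; rewrite ?oppr0 ?mul0r ?mulr0 subr0 divr1.
Qed.

End FactorMorphism.

(** Unlike the squares of [cauchy_partial], rectangles can be cut in the x-direction alone. *)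
Definition cauchy_rect (a b : nat) : fps Zbeta (nat + nat)%type :=
  \prod_(0 <= i < a) \prod_(0 <= j < b) cauchy_factor i j.

Definition in_rect (a b : nat) (v : nat + nat) : bool :=
  match v with inl i => (i < a)%N | inr j => (j < b)%N end.

Lemma rect_partial n : cauchy_partial n = cauchy_rect n n.
Proof.
rewrite /cauchy_partial /cauchy_rect big_mkord; apply: eq_bigr => i _.
by rewrite big_mkord.
Qed.

(** A factor becomes 1 as soon as one of its two variables is set to 0. *)
Lemma res_rect a b A B : (A <= a)%N -> (B <= b)%N ->
  fps_res (in_rect A B) (cauchy_rect a b) = cauchy_rect A B.
Proof.
move=> Aa Bb; rewrite rmorph_prod (big_cat_nat (n := A))//=.
rewrite [X in _ * X]big_nat [X in _ * X]big1 ?mulr1 => [|i /andP[Ai _]]; last first.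
  rewrite rmorph_prod big1// => j _; apply: cauchy_factor_morph1; first exact: fps_res_const.
  by left; rewrite /= /xvar /yvar fps_res_var /= ltnNge Ai.
apply: eq_big_nat => i /andP[_ iA]; rewrite rmorph_prod (big_cat_nat (n := B))//=.
rewrite [X in _ * X]big_nat [X in _ * X]big1 ?mulr1 => [|j /andP[Bj _]]; last first.
  apply: cauchy_factor_morph1; first exact: fps_res_const.
  by right; rewrite /= /xvar /yvar fps_res_var /= ltnNge Bj.
apply: eq_big_nat => j /andP[_ jB]; apply: cauchy_factor_morph; first exact: fps_res_const.
  by rewrite /= /xvar /yvar fps_res_var /= iA.
by rewrite /= /xvar /yvar fps_res_var /= jB.
Qed.

Lemma coef_rect a b A B (M : monom (nat + nat)%type) :
  (A <= a)%N -> (B <= b)%N -> all (in_rect A B) M ->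
  cauchy_rect a b M = cauchy_rect A B M.
Proof. by move=> Aa Bb AM; rewrite -(res_rect Aa Bb) /fps_res AM. Qed.

Lemma coef_cauchy A B (M : monom (nat + nat)%type) :
  all (in_rect A B) M -> cauchy M = cauchy_rect A B M.
Proof.
move=> AM; have [N HN] := cauchy_cvg M; pose n := (N + A + B)%N.
rewrite -(HN n) ?rect_partial; last by rewrite /n; lia.
by apply: coef_rect => //; rewrite /n; lia.
Qed.

Lemma exists_rect (M : monom (nat + nat)%type) : exists A, all (in_rect A A) M.
Proof.
elim: (enum_mset M) => [|v s [A IH]]; first by exists 0%N.
exists (A + (match v with inl i => i | inr j => j end).+1)%N => /=; apply/andP; split.
  by case: v => i /=; lia.
by apply: sub_all IH => -[i|i] /=; lia.
Qed.

(** Renumbers the alphabet x so that it follows z_1, ..., z_n. *)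
Definition shiftm n : monom nat -> monom nat := mmap (addn n).

Lemma res_coef0 (I : choiceType) (S : pred I) (f : fps Zbeta I) (m : monom I) :
  fps_res S f = f -> ~~ all S m -> f m = 0.
Proof. by move=> <- /negbTE; rewrite /fps_res => ->. Qed.

(** This is K(z, x; y) = K(z, y) K(x, y). A finite rectangle is cut at n into [f1], free of
    x-variables from n on, and [f2], free of those below n; only the y-part [k] is left to be
    split. *)
Lemma cauchy_coproduct n (m1 m2 k : monom nat) : all (fun i => i < n)%N m1 ->
  cauchy (pairm (m1 `+` shiftm n m2)%mset k) =
  \sum_(q <- splits k) cauchy (pairm m1 q.1) * cauchy (pairm m2 q.2).
Proof.
move=> m1n; set M := pairm _ k.
(* [B] bounds the variables of [M]. With [N] equal to n + B, the factor [f2] shifted back by n is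
   exactly the B by N rectangle. *)
have [B MB] := exists_rect M; pose N := (n + B)%N.
have MN : all (in_rect N N) M by apply: sub_all MB => -[i|i] /=; rewrite /N; lia.
rewrite (coef_cauchy MN).
pose f1 := cauchy_rect n N; pose f2 := \prod_(n <= i < N) \prod_(0 <= j < N) cauchy_factor i j.
have -> : cauchy_rect N N = f1 * f2 by rewrite /cauchy_rect (big_cat_nat (n := n))//= leq_addr.
have f1S : fps_res (in_rect n N) f1 = f1 by apply: res_rect.
pose S2 (v : nat + nat) := if v is inl i then (n <= i)%N else true.
have f2S : fps_res S2 f2 = f2.
  rewrite rmorph_prod; apply: eq_big_nat => i /andP[ni _].
  rewrite rmorph_prod; apply: eq_big_nat => j _.
  apply: cauchy_factor_morph; first exact: fps_res_const.
    by rewrite /= /xvar fps_res_var /= ni.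
  by rewrite /= /yvar fps_res_var.
pose h (v : nat + nat) : nat + nat := if v is inl i then inl (n + i)%N else v.
have h_inj : injective h by move=> [i|i] [j|j] // [E]; congr (_ _); lia.
have f2h : fps_pull h_inj f2 = cauchy_rect B N.
  rewrite rmorph_prod /N -{1}[n]add0n [(n + B)%N]addnC big_addn addnK.
  apply: eq_big_nat => i _; rewrite rmorph_prod; apply: eq_big_nat => j _.
  rewrite addnC; apply: cauchy_factor_morph; first exact: fps_pull_const.
    exact: (fps_pull_var _ h_inj (inl i)).
  exact: (fps_pull_var _ h_inj (inr j)).
have sh_inj : injective (addn n) by exact: addnI.
rewrite coef_splits (splits_pairm _ _ (fun a b => f1 a * f2 b)).
rewrite (splits_disjoint (fun a b => \sum_(q <- splits k)
    f1 (pairm a q.1) * f2 (pairm b q.2))); last first.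
  by move=> x /(allP m1n) xn; rewrite -mset_eq0 mmapN// => y; lia.
(* Variables below n do not occur in [f2], so all of [m1] goes to [f1]. *)
rewrite (sum_splits0r (F := fun a b => \sum_(r <- splits (shiftm n m2)) \sum_(q <- splits k)
    f1 (pairm (a `+` r.1)%mset q.1) * f2 (pairm (b `+` r.2)%mset q.2))); last first.
  move=> a b Eab b0; rewrite big1// => r _; rewrite big1// => q _.
  rewrite (res_coef0 f2S) ?mulr0//; move: b0; apply: contra.
  rewrite all_pairm all_msetD => /andP[/andP[/allP Sb _] _]; apply/eqP/msetP => x.
  rewrite mset0E; apply/eqP; rewrite mset_eq0; apply/negP => xb.
  have : x \in m1 by rewrite -Eab in_msetD xb orbT.
  by move/(allP m1n); have /= := Sb _ xb; lia.
(* Symmetrically, all of the shifted [m2] goes to [f2]. *)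
rewrite (sum_splits0l (F := fun a b => \sum_(q <- splits k)
    f1 (pairm (m1 `+` a)%mset q.1) * f2 (pairm (mset0 `+` b)%mset q.2))); last first.
  move=> a b Eab a0; rewrite big1// => q _.
  rewrite (res_coef0 f1S) ?mul0r//; move: a0; apply: contra.
  rewrite all_pairm all_msetD => /andP[/andP[_ /allP Sa] _]; apply/eqP/msetP => x.
  rewrite mset0E; apply/eqP; rewrite mset_eq0; apply/negP => xa.
  have : x \in shiftm n m2 by rewrite -Eab in_msetD xa.
  have := Sa _ xa => /= xn; rewrite -mset_neq0 mmapN// => y; lia.
rewrite big_seq [RHS]big_seq; apply: eq_bigr => q; rewrite mem_splits => /eqP Eq.
have [kN m2N] : all (fun j => j < N)%N k /\ all (fun i => i < B)%N m2.
  split; first by move: MN; rewrite all_pairm => /andP[].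
  move: MB; rewrite all_pairm all_msetD => /andP[/andP[_ +] _].
  rewrite (perm_all _ (perm_eq_seq_mset _)) all_map; apply: sub_all => i /=; lia.
move: kN; rewrite -Eq all_msetD => /andP[q1N q2N].
rewrite msetD0 mset0D (coef_cauchy (A := n) (B := N)); last first.
  by rewrite all_pairm m1n.
rewrite (coef_cauchy (A := B) (B := N)); last by rewrite all_pairm m2N.
congr (_ * _); rewrite -f2h /fps_pull; congr (f2 _).
apply/msetP => -[i|i]; last by rewrite pairm_r (mmapE h_inj _ (inr i)) pairm_r.
rewrite pairm_l; case: (leqP n i) => ni.
  by rewrite -(subnKC ni) /shiftm mmapE// (mmapE h_inj _ (inl (i - n)%N)) pairm_l.
by rewrite /shiftm !mmapN// => [[j|j]|j] //= => [[]|]; lia.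
Qed.

(** * Strict partitions and their shifted diagrams *)

Lemma partsP lam : sorted gtn (parts lam) /\ (0 \notin parts lam)%N.
Proof. by have /andP[] := valP lam. Qed.

Lemma part_eq0 lam i : (size (parts lam) <= i.-1)%N -> part lam i = 0%N.
Proof. exact: nth_default. Qed.

Lemma part_gt0 lam i : (i.-1 < size (parts lam))%N -> (0 < part lam i)%N.
Proof.
have [_ s0] := partsP lam; move=> il; rewrite lt0n.
by apply: contraNneq s0 => <-; exact: mem_nth.
Qed.

Lemma part_ltS lam i : (0 < i)%N -> (0 < part lam i.+1)%N -> (part lam i.+1 < part lam i)%N.
Proof.
have [ss _] := partsP lam; move=> i0 p.
have il : (i < size (parts lam))%N by case: ltnP => // il; rewrite part_eq0 in p.
have /(_ i.-1) /= := sortedP 0%N ss; rewrite prednK//; exact.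
Qed.

Lemma spart_ext lam mu : (forall i, (0 < i)%N -> part lam i = part mu i) -> lam = mu.
Proof.
move=> E; apply: val_inj => /=.
have sz : size (parts lam) = size (parts mu).
  wlog lt : lam mu E / (size (parts lam) < size (parts mu))%N => [H|].
    case: (ltngtP (size (parts lam)) (size (parts mu))) => // lt; first exact: H.
    by apply/esym/H => // i /E.
  have := part_gt0 (lam := mu) (i := (size (parts lam)).+1) lt.
  by rewrite -E// part_eq0.
by apply: (eq_from_nth (x0 := 0%N) sz) => i _; exact: (E i.+1).
Qed.

Lemma exists_spart (L : nat) (r : nat -> nat) :
  (forall i, (0 < r i.+1 -> r i.+1 < r i)%N) -> (forall i, (L <= i)%N -> r i = 0%N) ->
  exists lam, forall i, part lam i.+1 = r i.
Proof.
move=> rS; suff : forall L r, (forall i, (0 < r i.+1 -> r i.+1 < r i)%N) ->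
    (forall i, (L <= i)%N -> r i = 0%N) ->
    exists2 s, sorted gtn s && (0 \notin s)%N & forall i, nth 0%N s i = r i.
  move=> H /(H _ _ rS)[s Ps Es]; exists (Spart Ps) => i; exact: Es.
elim=> [|{}L IH] {}r {}rS r0.
  by exists [::] => // i; rewrite nth_nil r0.
have [s /andP[ss s0] Es] := IH (fun i => r i.+1) (fun i => rS i.+1) (fun i Li => r0 i.+1 Li).
have [r00|r0p] := posnP (r 0%N).
  exists [::] => // i; rewrite nth_nil; elim: i => // i /esym ri.
  by apply/eqP; rewrite eq_sym -leqn0 leqNgt; apply/negP => /rS; rewrite ri.
exists (r 0%N :: s) => [|[|i]] //=; rewrite inE negb_or s0.
have -> : (0 == r 0)%N = false by apply/negbTE; rewrite neq_ltn r0p.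
rewrite !andbT.
case: s ss s0 Es => //= x s -> xs Es; rewrite andbT.
move: xs; rewrite inE negb_or (Es 0%N : x = r 1%N) => /andP[p _].
by apply: rS; rewrite lt0n eq_sym.
Qed.

(** By strictness, the end [i + part lam i] of row i weakly decreases down the nonempty rows. *)
Lemma SD_down lam i j i' j' : (0 < i' <= j')%N -> (i' <= i)%N -> (j' <= j)%N ->
  (i, j) \in SD lam -> (i', j') \in SD lam.
Proof.
rewrite !in_SD => i'j' le_i le_j /andP[/andP[i0 ij] ji]; rewrite i'j' /=.
suff : (i + part lam i <= i' + part lam i')%N by lia.
have p0 : (0 < part lam i)%N by lia.
case/andP: i'j' => i'0 _ {ij ji le_j}.
elim: i le_i i0 p0 => [|i IH]; first lia.
rewrite leq_eqVlt => /predU1P[<-//|le_i] _ p0.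
have i0 : (0 < i)%N by lia.
have := part_ltS i0 p0; have := IH le_i i0; lia.
Qed.

Lemma SD_inj lam mu : SD lam = SD mu -> lam = mu.
Proof.
move=> E; apply: spart_ext => i i0.
have H a b (ab : SD a = SD b) : (part a i <= part b i)%N.
  case: (posnP (part a i)) => [->//|p].
  have : (i, (i + part a i).-1) \in SD a by rewrite in_SD; lia.
  rewrite ab in_SD; lia.
by apply/eqP; rewrite eqn_leq !H.
Qed.

Lemma psubP mu lam : psub mu lam <-> {subset SD mu <= SD lam}.
Proof.
split=> [H [i j]|H i]; first by rewrite !in_SD; have := H i; lia.
wlog i0 : i / (0 < i)%N => [W|].
  by case: i => [|i]; [exact: (W 1%N)|exact: W].
case: (posnP (part mu i)) => [->//|p].
have /H : (i, (i + part mu i).-1) \in SD mu by rewrite in_SD; lia.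
rewrite in_SD; lia.
Qed.

(** Converse of [SD_down]: an order ideal of a shifted diagram is a shifted diagram. Row lengths are
    read off at the first missing box of each row. *)
Lemma exists_SD lam (D : {fset nat * nat}) : {subset D <= SD lam} ->
  (forall i j i' j', (0 < i' <= j')%N -> (i' <= i)%N -> (j' <= j)%N ->
    (i, j) \in D -> (i', j') \in D) ->
  exists mu, SD mu = D.
Proof.
move=> Dlam Ddown.
pose r i := find (fun k => (i.+1, i.+1 + k)%N \notin D) (iota 0 (part lam i.+1)).
have r_le i : (r i <= part lam i.+1)%N by rewrite -[leqRHS](size_iota 0) find_size.
have rP i j : ((i.+1, j) \in D) = (i.+1 <= j < i.+1 + r i)%N.
  apply/idP/idP => [Dij|/andP[ij jr]].
    have := Dlam _ Dij; rewrite in_SD => /andP[/andP[_ ij] jp]; rewrite ij ltnNge /=.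
    apply/negP => rj; have rp : (r i < part lam i.+1)%N by lia.
    have := nth_find 0%N (a := fun k => (i.+1, i.+1 + k)%N \notin D)
      (s := iota 0 (part lam i.+1)).
    rewrite has_find size_iota rp => /(_ isT); rewrite nth_iota// => /negP; apply.
    by rewrite -/(r i); apply: Ddown Dij; lia.
  have := before_find 0%N (a := fun k => (i.+1, i.+1 + k)%N \notin D)
    (s := iota 0 (part lam i.+1)) (i := (j - i.+1)%N).
  rewrite nth_iota; last by have := r_le i; lia.
  rewrite add0n subnKC// => H; apply/negPn; rewrite H//.
  by rewrite -/(r i); lia.
have [mu Emu] : exists mu, forall i, part mu i.+1 = r i.
  apply: (exists_spart (L := size (parts lam))) => [i ri|i li]; last first.
    by apply/eqP; rewrite -leqn0 (leq_trans (r_le i))// part_eq0.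
  (* This box lies just above the last box of the next row. Since row [i.+1] starts one column
     before that row, containing it makes row [i.+1] strictly longer. *)
  have : (i.+1, i.+1 + r i.+1)%N \in D.
    apply: (@Ddown i.+2 (i.+1 + r i.+1)%N); rewrite ?rP; lia.
  rewrite rP; lia.
exists mu; apply/fsetP => -[[|i] j]; last by rewrite rP in_SD Emu.
by rewrite in_SD; apply/esym/negbTE/negP => /Dlam; rewrite in_SD.
Qed.

Lemma card_SD lam : #|` SD lam| = psize lam.
Proof.
rewrite /SD card_fseq undup_id; last first.
  apply: allpairs_uniq_dep; rewrite ?iota_uniq//; first by move=> i _; exact: iota_uniq.
  move=> [i j] [i' j'] /= ? ? [E1 E2].
  by rewrite E1 E2.
rewrite size_allpairs_dep (eq_map (g := part lam)) => [|i]; last by rewrite size_iota.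
congr (sumn _); rewrite -[1%N]addn0 iotaDl -map_comp; apply: (eq_from_nth (x0 := 0%N)).
  by rewrite size_map size_iota.
by move=> i; rewrite size_map size_iota => il; rewrite (nth_map 0%N) ?size_iota// nth_iota.
Qed.

Lemma psize_psub mu lam : psub mu lam -> (psize mu <= psize lam)%N.
Proof. by move/psubP => H; rewrite -!card_SD; apply: fsubset_leq_card; apply/fsubsetP. Qed.

(** A strict partition is recovered from the set of its parts by sorting, and these parts are at
    most [N]. *)
Lemma finite_psize N : finite_set [set lam | (psize lam <= N)%N].
Proof.
pose f (A : {fset nat}) : spart := insubd spart0 [seq i <- rev (iota 0 N.+1) | i \in A].
apply: (@sub_finite_set _ _ (f @` [set` fpowerset [fset x in iota 0 N.+1]%fset])).
  move=> lam /= lN; exists [fset x in parts lam]%fset.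
    rewrite /= fpowersetE; apply/fsubsetP => x; rewrite !inE /= mem_iota => xl.
    by move: lN; rewrite /psize (perm_sumn (perm_to_rem xl)) /=; lia.
  rewrite /f; have -> : [seq i <- rev (iota 0 N.+1) | i \in [fset x in parts lam]%fset] = parts lam.
    have [ss _] := partsP lam.
    have gt_trans : transitive gtn by move=> x y z /= ? ?; lia.
    apply: (irr_sorted_eq gt_trans) => [x /=|||x].
    - by rewrite ltnn.
    - by apply: (sorted_filter gt_trans); rewrite rev_sorted; exact: iota_ltn_sorted.
    - exact: ss.
    rewrite mem_filter inE andbC mem_rev mem_iota; apply/andP/idP => [[]//|xl]; split=> //.
    by move: lN; rewrite /psize (perm_sumn (perm_to_rem xl)) /=; lia.
  by rewrite valKd.
exact/finite_image/finite_fset.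
Qed.

Definition pfin N : {fset spart} := fset_set [set lam | (psize lam <= N)%N].

Lemma mem_pfin N lam : (lam \in pfin N) = (psize lam <= N)%N.
Proof.
rewrite in_fset_set; last exact: finite_psize.
by apply/idP/idP => [/set_mem|?]; rewrite ?inE.
Qed.

Lemma fsum_pfin (R : nmodType) N (F : spart -> R) :
  (forall lam, F lam != 0 -> (psize lam <= N)%N) ->
  \sum_(lam \in [set: spart]) F lam = \sum_(lam <- pfin N) F lam.
Proof.
move=> H; apply: fsbigTE => lam; rewrite mem_pfin => /negP n.
by apply/eqP/negPn/negP => /H.
Qed.

Lemma pfin_widen (R : nmodType) N N' (F : spart -> R) :
  (forall lam, F lam != 0 -> (psize lam <= N)%N) -> (N <= N')%N ->
  \sum_(lam <- pfin N') F lam = \sum_(lam <- pfin N) F lam.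
Proof.
by move=> H NN'; rewrite -!fsum_pfin// => lam /H /leq_trans; apply.
Qed.

(** * The skew Cauchy identity from a coproduct and independence *)

Section Assembly.
Implicit Types (m k : monom nat).
Variables (GS : spart -> spart -> fps Zbeta nat) (g : spart -> fps Zbeta nat).
Variable c : spart -> spart -> spart -> int.
Let G lam := GS lam spart0.
Let D := dskew GS.
Hypothesis GS_degree : forall lam mu m,
  GS lam mu m != 0 -> (psize lam <= size m + psize mu)%N.
Hypothesis G_coproduct : forall n lam (m1 m2 : monom nat), all (fun i => i < n)%N m1 ->
  G lam (m1 `+` shiftm n m2)%mset = \sum_(mu <- pfin (size m1)) G mu m1 * D lam mu m2.
(** Independence even for infinite combinations: by degree, partitions outside [pfin (size m)] do
    not contribute to the coefficient of [m]. *)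
Hypothesis G_independent : forall C : spart -> Zbeta,
  (forall m : monom nat, \sum_(mu <- pfin (size m)) G mu m * C mu = 0) -> forall mu, C mu = 0.
Hypothesis G_dual : is_dual G g.
Hypothesis G_structure : is_structure_constants G c.

Let K m k := cauchy (pairm m k).
Let A lam mu nu : Zbeta := (c lam mu nu)%:~R * 'X^(psize lam - psize mu - psize nu).
Let gs := dual_skew c g.

Let G_degree lam m : G lam m != 0 -> (psize lam <= size m)%N.
Proof. by move/GS_degree; rewrite addn0. Qed.

Let A_degree lam mu nu : A lam mu nu != 0 -> (psize mu + psize nu <= psize lam)%N.
Proof.
case: G_structure => c0 _; apply: contraNT; rewrite -ltnNge /A => /c0 ->.
by rewrite mul0r.
Qed.

Let coef_bcoefM lam mu nu f m : (bcoef c lam mu nu * f) m = A lam mu nu * f m.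
Proof. by rewrite /bcoef -mulrA coef_intM coef_constXM mulrA. Qed.

(** These two bounds make both sides of the identity finite in each coefficient: the degree in x
    bounds lambda on the left, and kappa is contained in nu on the right. *)
Lemma dskew_neq0 lam mu m : D lam mu m != 0 ->
  psub mu lam /\ (psize lam <= size m + psize mu)%N.
Proof.
rewrite /D /dskew; case: asboolP => [ml|_]; last by rewrite coef_fps0 eqxx.
rewrite /fps_sum => H; split=> //.
have [nu [nm _] n0] := @fsbigN1 _ _ _ unit _ _ (fun _ nu =>
  (beta ^+ #|` skewSD mu nu| * GS lam nu) m) tt H.
have /GS_degree : GS lam nu m != 0.
  by apply: contraNneq n0 => E; rewrite coef_constXM E mulr0.
by have := psize_psub nm; lia.
Qed.

Let gsE N lam nu k : (psize lam <= N)%N ->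
  gs lam nu k = \sum_(kap <- pfin N) A lam nu kap * g kap k.
Proof.
move=> lN; rewrite /gs /dual_skew /fps_sum (fsum_pfin (N := N)) => [|kap].
  by apply: eq_bigr => kap _; rewrite coef_bcoefM.
rewrite coef_bcoefM => n0; have /A_degree : A lam nu kap != 0; last by lia.
by apply: contraNneq n0 => ->; rewrite mul0r.
Qed.

Let dualE N m k : (size m <= N)%N -> \sum_(lam <- pfin N) G lam m * g lam k = K m k.
Proof.
move=> mN; case: G_dual => _ E; rewrite /K -E /fps_sum (fsum_pfin (N := N)) => [|lam].
  by apply: eq_bigr => lam _; rewrite coef_xy.
rewrite coef_xy => n0; have /G_degree : G lam m != 0; last by lia.
by apply: contraNneq n0 => ->; rewrite mul0r.
Qed.

Let structureE N mu nu m : (size m <= N)%N ->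
  \sum_(lam <- pfin N) A lam mu nu * G lam m = (G mu * G nu) m.
Proof.
move=> mN; case: G_structure => _ /(_ mu nu)[_ ->].
rewrite /fps_sum (fsum_pfin (N := N)) => [|lam].
  by apply: eq_bigr => lam _; rewrite coef_bcoefM.
rewrite coef_bcoefM => n0; have /G_degree : G lam m != 0; last by lia.
by apply: contraNneq n0 => ->; rewrite mulr0.
Qed.

Lemma skew_cauchy_right N nu m k : (size m <= N)%N ->
  \sum_(lam <- pfin N) G lam m * gs lam nu k = \sum_(p <- splits m) G nu p.1 * K p.2 k.
Proof.
move=> mN; rewrite big_seq.
under eq_bigr => lam do rewrite mem_pfin => /(gsE nu k) ->.
rewrite -big_seq; under eq_bigr do rewrite mulr_sumr.
rewrite exchange_big /=.
transitivity (\sum_(kap <- pfin N) (G nu * G kap) m * g kap k).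
  apply: eq_bigr => kap _; rewrite -(structureE nu kap mN) mulr_suml.
  by apply: eq_bigr => lam _; rewrite mulrCA mulrA.
under [LHS]eq_bigr => kap _ do rewrite (coef_splits (G nu) (G kap)) mulr_suml.
rewrite exchange_big /= big_seq [RHS]big_seq; apply: eq_bigr => p /splits_size[_ p2].
rewrite -(dualE k (leq_trans p2 mN)) mulr_sumr.
by apply: eq_bigr => kap _; rewrite mulrA.
Qed.

(** [L] and [Q] are the coefficients of x^m y^k in the sums over lambda and over kappa. *)
Let L mu nu m k := \sum_(lam <- pfin (size m + psize mu)) D lam mu m * gs lam nu k.
Let Q mu nu m k := \sum_(kap <- pfin (psize nu)) D nu kap m * gs mu kap k.

(** A summation range independent of [m1] allows this sum to be exchanged with the sum over the
    splittings of [m1]. *)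
Let G_coproduct' n nu (m1 m2 : monom nat) : all (fun i => i < n)%N m1 ->
  G nu (m1 `+` shiftm n m2)%mset = \sum_(kap <- pfin (psize nu)) G kap m1 * D nu kap m2.
Proof.
move=> m1n; rewrite (G_coproduct _ _ m1n) -!fsum_pfin// => kap n0.
  have /dskew_neq0[/psize_psub//] : D nu kap m2 != 0.
  by apply: contraNneq n0 => ->; rewrite mulr0.
apply: G_degree; by apply: contraNneq n0 => ->; rewrite mul0r.
Qed.

Lemma skew_cauchy_coef mu nu m2 k : L mu nu m2 k =
  \sum_(r <- splits m2) \sum_(q <- splits k) Q mu nu r.1 q.1 * K r.2 q.2.
Proof.
(* The difference of the two sides, as a function of [mu], is the family of coefficients to which
   independence applies; it is tested on each monomial z^m1. *)
apply/eqP; rewrite -subr_eq0; apply/eqP; move: mu; apply: G_independent => m1.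
pose n := (\max_(i <- m1) i).+1.
have m1n : all (fun i => i < n)%N m1.
  by apply/allP => i im; rewrite ltnS (big_rem i im)/= leq_maxl.
under eq_bigr do rewrite mulrBr.
rewrite sumrB; apply/eqP; rewrite subr_eq0; apply/eqP.
pose m := (m1 `+` shiftm n m2)%mset.
have sm : size m = (size m1 + size m2)%N by rewrite size_mset_add size_mmap.
(* Both sides compute the coefficient of z^m1 x^m2 y^k in sum_lam G_lam(z, x) g_(lam/nu)(y): one by
   the coproduct of [G lam], the other by (1) and the coproducts of [G nu] and of the kernel. *)
transitivity (\sum_(lam <- pfin (size m)) G lam m * gs lam nu k).
  under [RHS]eq_bigr do rewrite G_coproduct// mulr_suml.
  rewrite exchange_big /= big_seq [RHS]big_seq; apply: eq_bigr => mu; rewrite mem_pfin => mum.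
  rewrite /L mulr_sumr -(pfin_widen (N' := size m)).
  - by apply: eq_bigr => lam _; rewrite mulrA.
  - move=> lam n0; have /dskew_neq0[] // : D lam mu m2 != 0.
    by apply: contraNneq n0 => ->; rewrite mul0r mulr0.
  - by rewrite sm addnC leq_add2r.
rewrite skew_cauchy_right// /m (splits_disjoint (fun a b => G nu a * K b k)); last first.
  by move=> x /(allP m1n) xn; rewrite -mset_eq0 mmapN// => y; lia.
transitivity (\sum_(r <- splits m2) \sum_(q <- splits k) \sum_(kap <- pfin (psize nu))
   D nu kap r.1 * K r.2 q.2 * \sum_(p <- splits m1) G kap p.1 * K p.2 q.1).
  transitivity (\sum_(p <- splits m1) \sum_(r <- splits m2) \sum_(q <- splits k)
      \sum_(kap <- pfin (psize nu)) D nu kap r.1 * K r.2 q.2 * (G kap p.1 * K p.2 q.1)).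
    rewrite big_seq [RHS]big_seq; apply: eq_bigr => -[p1 p2]; rewrite mem_splits /= => /eqP E.
    have [p1n p2n] : all (fun i => i < n)%N (p1 : monom nat) /\
        all (fun i => i < n)%N (p2 : monom nat).
      by apply/andP; rewrite -all_msetD E.
    rewrite (splits_mmap (@addnI n) _ (fun a b => G nu (p1 `+` a)%mset * K (p2 `+` b)%mset k)).
    apply: eq_bigr => -[r1 r2] _ /=; rewrite G_coproduct'// /K cauchy_coproduct// mulr_sumr.
    apply: eq_bigr => -[q1 q2] _ /=; rewrite mulr_suml; apply: eq_bigr => kap _.
    by ring.
  rewrite exchange_big; apply: eq_bigr => r _ /=.
  rewrite exchange_big; apply: eq_bigr => q _ /=.
  by rewrite exchange_big; apply: eq_bigr => kap _ /=; rewrite mulr_sumr.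
under [RHS]eq_bigr do rewrite mulr_sumr.
rewrite [RHS]exchange_big; apply: eq_bigr => r _ /=.
under [RHS]eq_bigr do rewrite mulr_sumr.
rewrite [RHS]exchange_big; apply: eq_bigr => q _ /=.
(* The second use of (1), read from right to left in the alphabet z with [kap] for [nu]. *)
under eq_bigr => kap _ do rewrite -(skew_cauchy_right kap q.1 (leqnn _)) mulr_sumr.
rewrite exchange_big; apply: eq_bigr => mu _ /=.
rewrite mulr_suml mulr_sumr; apply: eq_bigr => kap _.
by ring.
Qed.

Lemma fps_summable_psize (F : spart -> fps Zbeta (nat + nat)%type) :
  (forall m k, exists N, forall lam, F lam (pairm m k) != 0 -> (psize lam <= N)%N) ->
  fps_summable [set: spart] F.
Proof.
move=> H M; have [m [k ->]] := pairm_surj M; have [N HN] := H m k.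
apply: (@sub_finite_set _ _ [set lam | (psize lam <= N)%N]); last exact: finite_psize.
by move=> lam /= [_ /HN].
Qed.

Theorem skew_cauchy mu nu :
  [/\ fps_summable [set: spart] (fun lam => in_x (D lam mu) * in_y (gs lam nu)),
      fps_summable [set: spart] (fun kap => in_x (D nu kap) * in_y (gs mu kap)) &
      fps_sum [set: spart] (fun lam => in_x (D lam mu) * in_y (gs lam nu)) =
      cauchy * fps_sum [set: spart] (fun kap => in_x (D nu kap) * in_y (gs mu kap))].
Proof.
have degL m k lam : (in_x (D lam mu) * in_y (gs lam nu)) (pairm m k) != 0 ->
    (psize lam <= size m + psize mu)%N.
  rewrite coef_xy => n0; have /dskew_neq0[] // : D lam mu m != 0.
  by apply: contraNneq n0 => ->; rewrite mul0r.
have degQ m k kap : (in_x (D nu kap) * in_y (gs mu kap)) (pairm m k) != 0 ->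
    (psize kap <= psize nu)%N.
  rewrite coef_xy => n0; have /dskew_neq0[/psize_psub] // : D nu kap m != 0.
  by apply: contraNneq n0 => ->; rewrite mul0r.
split.
- by apply: fps_summable_psize => m k; exists (size m + psize mu)%N => lam /degL.
- by apply: fps_summable_psize => m k; exists (psize nu) => lam /degQ.
apply/funext => M; have [m [k ->]] := pairm_surj M.
rewrite mulrC coef_splits (splits_pairm _ _ (fun a b => fps_sum _ _ a * cauchy b)).
rewrite /fps_sum (fsum_pfin (N := size m + psize mu)); last by move=> lam /degL.
under eq_bigr do rewrite coef_xy.
rewrite [LHS]skew_cauchy_coef; apply: eq_bigr => r _; apply: eq_bigr => q _.
rewrite (fsum_pfin (N := psize nu)); last by move=> lam /degQ.
by congr (_ * _); apply: eq_bigr => kap _; rewrite coef_xy.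
Qed.

End Assembly.

(** * Cutting and gluing tableaux *)

Notation box := (nat * nat)%type.
Notation cells := {fset box * nat}.

(* A tableau is encoded as the set of its pairs (box, entry); the flag dg forbids
   primed diagonal entries. *)
Definition is_tab (dg : bool) (lam mu : spart) (F : cells) : Prop :=
  [/\ forall b, b \in skewSD lam mu <-> exists k, (b, k) \in F,
      forall i j j' k l, (i, j, k) \in F -> (i, j', l) \in F -> (j < j')%N ->
        (k <= l)%N /\ (k = l -> odd k),
      forall i i' j k l, (i, j, k) \in F -> (i', j, l) \in F -> (i < i')%N ->
        (k <= l)%N /\ (k = l -> ~~ odd k) &
      dg -> forall i k, (i, i, k) \in F -> odd k].

Definition wt (F : cells) : monom nat := seq_mset [seq p.2./2 | p <- F].

Lemma size_wt F : size (wt F) = #|` F|.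
Proof. by rewrite (perm_size (perm_eq_seq_mset _)) size_map. Qed.

Lemma mem_wt F b k : (b, k) \in F -> k./2 \in wt F.
Proof.
move=> bF; rewrite (perm_mem (perm_eq_seq_mset _)).
by apply/mapP; exists (b, k).
Qed.

Lemma skewSD0 lam : skewSD lam spart0 = SD lam.
Proof.
apply/fsetP => -[i j]; rewrite /skewSD in_fsetD in_SD /part nth_nil addn0.
by case: ltnP; rewrite ?andbF //= => ?; case: (_ \in SD lam) => //=; rewrite ?andbT; lia.
Qed.

Lemma psub0 lam : psub spart0 lam.
Proof. by move=> i; rewrite /part nth_nil. Qed.

(** * Monotonicity and row bounds in straight shapes *)

Section Straight.
Variables (dg : bool) (lam : spart) (F : cells).
Hypothesis tabF : is_tab dg lam spart0 F.

Lemma tab_SD b k : (b, k) \in F -> b \in SD lam.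
Proof. by case: tabF => S _ _ _ bk; rewrite -skewSD0; apply/S; exists k. Qed.

Lemma tab_entry b : b \in SD lam -> exists k, (b, k) \in F.
Proof. by case: tabF => S _ _ _; rewrite -skewSD0 => /S. Qed.

(** Compare through an entry of the corner box (i, j'), which [SD_down] places in the diagram. *)
Lemma tab_mono i j i' j' k l : (i, j, k) \in F -> (i', j', l) \in F ->
  (i <= i')%N -> (j <= j')%N -> (i, j) != (i', j') -> (k <= l)%N.
Proof.
move=> kF lF ii jj ne; have [_ R C _] := tabF.
have := tab_SD kF; have := tab_SD lF; rewrite !in_SD => l1 l2.
have [e eF] : exists e, (i, j', e) \in F.
  by apply: tab_entry; apply: (SD_down _ _ _ (tab_SD lF)); lia.
have [E|lt_j] : j = j' \/ (j < j')%N by lia.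
  have [E'|lt_i] : i = i' \/ (i < i')%N by lia.
    by rewrite E E' eqxx in ne.
  by rewrite E in kF; case: (C _ _ _ _ _ kF lF lt_i).
have [] := R _ _ _ _ _ kF eF lt_j; have [E'|lt_i] : i = i' \/ (i < i')%N by lia.
  by rewrite E' in kF; have [] := R _ _ _ _ _ kF lF lt_j.
have [] := C _ _ _ _ _ eF lF lt_i; lia.
Qed.

(* If the diagonal boxes i and i + 1 had entries of the same absolute value a, the
   box (i, i + 1) would repeat a' in its row or a in its column. *)
Lemma tab_row_le i j k : (i, j, k) \in F -> (i <= k./2.+1)%N.
Proof.
have [_ R C _] := tabF.
have diag : forall i k, (i, i, k) \in F -> (i <= k./2.+1)%N.
  elim=> // {}i IH {}k kF; case: i IH kF => // i IH kF.
  have := tab_SD kF => S.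
  have [e eF] : exists e, (i.+1, i.+1, e) \in F.
    by apply: tab_entry; apply: (SD_down _ _ _ S); lia.
  have [f fF] : exists f, (i.+1, i.+2, f) \in F.
    by apply: tab_entry; apply: (SD_down _ _ _ S); lia.
  have := IH _ eF; have [] := R _ _ _ _ _ eF fF (ltnSn _).
  have [] := C _ _ _ _ _ fF kF (ltnSn _); lia.
move=> kF; have := tab_SD kF; rewrite in_SD => ij.
have [e eF] : exists e, (i, i, e) \in F.
  by apply: tab_entry; apply: (SD_down _ _ _ (tab_SD kF)); lia.
have := diag _ _ eF; have [E|lt_j] : i = j \/ (i < j)%N by lia.
  by rewrite E in kF *; move=> _; exact: diag kF.
have [] := R _ _ _ _ _ eF kF lt_j; lia.
Qed.

End Straight.

(** * The bijection behind the coproduct *)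

Section Glue.
Variable n : nat.

(** Each variable has two codes, so passing n variables adds 2n; this preserves parity, hence
    primes. *)
Definition shift_cell (p : box * nat) : box * nat := (p.1, p.2 + n.*2)%N.

Lemma shift_cell_inj : injective shift_cell.
Proof. by move=> [b k] [b' k'] [-> /addIn ->]. Qed.

Definition glue (F1 F2 : cells) : cells := (F1 `|` [fset shift_cell p | p in F2])%fset.

Definition small (F : cells) := forall b k, (b, k) \in F -> (k < n.*2)%N.

Lemma mem_glue F1 F2 b k : small F1 ->
  ((b, k) \in glue F1 F2) = if (k < n.*2)%N then (b, k) \in F1 else (b, (k - n.*2)%N) \in F2.
Proof.
move=> sF1; rewrite in_fsetU; case: ltnP => kn.
  apply/orP/idP => [[//|/imfsetP[[b' k'] _ [_ E]]]|]; last by left.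
  by move: kn; rewrite E; lia.
apply/orP/idP => [[/sF1|/imfsetP[[b' k'] /= kF [-> ->]]]|kF].
- lia.
- by rewrite addnK.
- by right; apply/imfsetP; exists (b, k - n.*2)%N => //; rewrite /shift_cell /= subnK.
Qed.

Lemma perm_glue F1 F2 : small F1 -> perm_eq (glue F1 F2) (F1 ++ [seq shift_cell p | p <- F2]).
Proof.
move=> sF1; apply: uniq_perm => [||[b k]].
- exact: fset_uniq.
- rewrite cat_uniq fset_uniq map_inj_uniq ?fset_uniq ?andbT//; last exact: shift_cell_inj.
  apply/hasPn => _ /mapP[[b k] _ ->]; apply/negP => /sF1; lia.
- rewrite mem_cat in_fsetU; congr (_ || _).
  by apply/imfsetP/mapP => -[p pF E]; exists p.
Qed.

Lemma wt_glue F1 F2 : small F1 -> wt (glue F1 F2) = (wt F1 `+` shiftm n (wt F2))%mset.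
Proof.
move=> sF1; apply: (etrans (_ : _ =
     seq_mset [seq p.2./2 | p <- F1 ++ [seq shift_cell p | p <- F2]])).
  by apply/eq_seq_msetP/perm_map/perm_glue.
apply/msetP => x; rewrite mset_seqE map_cat count_cat msetE2 /wt mset_seqE; congr addn.
rewrite /shiftm /mmap mset_seqE -map_comp.
have /permP -> := perm_map (addn n) (perm_eq_seq_mset [seq p.2./2 | p <- F2]).
rewrite -map_comp; congr count; apply: eq_map => p /=; lia.
Qed.

Lemma glue_inj F1 F2 F1' F2' : small F1 -> small F1' ->
  glue F1 F2 = glue F1' F2' -> F1 = F1' /\ F2 = F2'.
Proof.
move=> s s' /fsetP E; split; apply/fsetP => -[b k].
  move: (E (b, k)); rewrite !mem_glue//; case: ltnP => // kn _.
  by apply/idP/idP => [/s|/s']; lia.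
by move: (E (b, (k + n.*2)%N)); rewrite !mem_glue// ltnNge leq_addl /= addnK.
Qed.

(** The shapes left by a cut: [mu] holds the boxes with some entry below it, [nu] those with all
    entries below it. *)
Definition good_pair (lam mu nu : spart) : Prop :=
  [/\ psub mu lam, psub nu mu & forall b, b \in skewSD mu nu -> removable mu b].

(** Otherwise removing (i, j) would leave a diagram that contains (i', j') but not (i, j), against
    [SD_down]. *)
Lemma removable_max mu i j i' j' : removable mu (i, j) -> (i', j') \in SD mu ->
  (i <= i')%N -> (j <= j')%N -> (i', j') = (i, j).
Proof.
move=> [bS [nu E]] cS ii jj; apply/eqP/negPn/negP => ne.
have : (i', j') \in SD nu by rewrite E in_fsetD1 ne.
move=> /(SD_down (i' := i) (j' := j)); rewrite E in_fsetD1 eqxx /= => H.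
by have : false by apply: H => //; move: bS; rewrite in_SD => /andP[].
Qed.

Lemma glue_tab dg lam mu nu F1 F2 : good_pair lam mu nu -> small F1 ->
  is_tab dg mu spart0 F1 -> is_tab dg lam nu F2 -> is_tab dg lam spart0 (glue F1 F2).
Proof.
move=> [ml nm rem] s t1 [S2 R2 C2 D2].
have [S1 R1 C1 D1] := t1.
have mem2 b k : (n.*2 <= k)%N -> (b, k) \in glue F1 F2 -> (b, k - n.*2)%N \in F2.
  by move=> kn; rewrite mem_glue// ltnNge kn.
have mem1 b k : (k < n.*2)%N -> (b, k) \in glue F1 F2 -> (b, k) \in F1.
  by move=> kn; rewrite mem_glue// kn.
(* A large entry cannot lie northwest of a small one in another box: its box would be in [mu] but
   not in [nu], hence removable, hence maximal in [mu]. *)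
have clash i j i' j' k l : (i, j, k) \in F2 -> (i', j', l) \in F1 ->
    (i <= i')%N -> (j <= j')%N -> (i, j) != (i', j') -> False.
  move=> kF lF ii jj ne; have cS := tab_SD t1 lF.
  have : (i, j) \in skewSD lam nu by apply/S2; exists k.
  rewrite in_fsetD => /andP[bnu bl].
  have bmu : (i, j) \in SD mu.
    by apply: SD_down cS => //; move: bl; rewrite in_SD => /andP[].
  have /rem r : (i, j) \in skewSD mu nu by rewrite in_fsetD bnu.
  by move: ne; rewrite (removable_max r cS ii jj) eqxx.
split.
- move=> b; rewrite skewSD0; split=> [bl|[k]].
    have [bm|bm] := boolP (b \in SD mu).
      have [k kF] := tab_entry t1 bm; exists k; rewrite mem_glue// (s _ _ kF)//.
    have [k kF] : exists k, (b, k) \in F2.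
      apply/S2; rewrite in_fsetD bl andbT; by apply: contra bm; exact: (psubP nu mu).1.
    by exists (k + n.*2)%N; rewrite mem_glue// ltnNge leq_addl /= addnK.
  rewrite mem_glue//; case: ifP => _ kF.
    exact: (psubP mu lam).1 ml _ (tab_SD t1 kF).
  have : b \in skewSD lam nu by apply/S2; eexists; exact: kF.
  by rewrite in_fsetD => /andP[].
- move=> i j j' k l kF lF jj; have [kn|kn] := ltnP k n.*2; have [ln|ln] := ltnP l n.*2.
  + exact: R1 (mem1 _ _ kn kF) (mem1 _ _ ln lF) jj.
  + by split; lia.
  + case: (clash _ _ _ _ _ _ (mem2 _ _ kn kF) (mem1 _ _ ln lF)) => //; first exact: ltnW.
    by rewrite xpair_eqE; lia.
  + have := R2 _ _ _ _ _ (mem2 _ _ kn kF) (mem2 _ _ ln lF) jj; lia.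
- move=> i i' j k l kF lF ii; have [kn|kn] := ltnP k n.*2; have [ln|ln] := ltnP l n.*2.
  + exact: C1 (mem1 _ _ kn kF) (mem1 _ _ ln lF) ii.
  + by split; lia.
  + case: (clash _ _ _ _ _ _ (mem2 _ _ kn kF) (mem1 _ _ ln lF)) => //; first exact: ltnW.
    by rewrite xpair_eqE; lia.
  + have := C2 _ _ _ _ _ (mem2 _ _ kn kF) (mem2 _ _ ln lF) ii; lia.
- move=> d i k kF; have [kn|kn] := ltnP k n.*2; first exact: D1 (mem1 _ _ kn kF).
  have := D2 d _ _ (mem2 _ _ kn kF); lia.
Qed.

Lemma split_tab dg lam F : is_tab dg lam spart0 F -> exists mu nu F1 F2,
  [/\ good_pair lam mu nu, small F1, is_tab dg mu spart0 F1, is_tab dg lam nu F2 &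
      F = glue F1 F2].
Proof.
move=> t; have [S R C D] := t.
pose F1 : cells := [fset p in F | (p.2 < n.*2)%N]%fset.
pose F2 : cells := [fset (p.1, (p.2 - n.*2)%N) | p in F & (n.*2 <= p.2)%N]%fset.
have memF1 b k : ((b, k) \in F1) = ((b, k) \in F) && (k < n.*2)%N by rewrite !inE.
have memF2 b k : ((b, k) \in F2) = ((b, (k + n.*2)%N) \in F).
  apply/imfsetP/idP => [[[b' k'] /= + [-> ->]]|kF].
    by rewrite !inE /= => /andP[kF kn]; rewrite subnK.
  exists (b, (k + n.*2)%N); last by rewrite /= addnK.
  by rewrite inE /= kF leq_addl.
have s1 : small F1 by move=> b k; rewrite memF1 => /andP[].
have down i j i' j' k : (0 < i' <= j')%N -> (i' <= i)%N -> (j' <= j)%N -> (i, j, k) \in F ->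
    (i', j') \in SD lam /\ forall l, (i', j', l) \in F -> (i', j') != (i, j) -> (l <= k)%N.
  move=> ij ii jj kF; split; first exact: SD_down (tab_SD t kF).
  by move=> l lF ne; exact: (tab_mono t lF kF).
(* A box northwest of one with a small entry has only smaller or equal entries, so the boxes with a
   small entry form an order ideal. Dually, for [nu], the boxes with a large entry are closed
   towards the southeast. *)
have [mu Emu] : exists mu, SD mu = [fset p.1 | p in F1]%fset.
  apply: (@exists_SD lam) => [b /imfsetP[[c k] /=]|i j i' j' ij ii jj /imfsetP[[c k] /=]].
    by rewrite memF1 => /andP[kF _] -> /=; exact: (tab_SD t kF).
  rewrite memF1 => /andP[kF kn] E; rewrite -E in kF.
  have [bS H] := down _ _ _ _ _ ij ii jj kF.
  have [E'|ne] := eqVneq (i', j') (i, j).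
    by apply/imfsetP; exists (i, j, k); rewrite ?memF1 ?kF.
  have [l lF] := tab_entry t bS; apply/imfsetP; exists (i', j', l) => //.
  by rewrite memF1 lF; have := H _ lF ne; lia.
have [nu Enu] : exists nu, SD nu = (SD lam `\` [fset p.1 | p in F2])%fset.
  apply: (@exists_SD lam) => [b|i j i' j' ij ii jj]; rewrite in_fsetD => /andP[nb bS] //.
  have cS := SD_down ij ii jj bS; rewrite in_fsetD cS andbT.
  apply: contra nb => /imfsetP[[c l] /= lF E]; rewrite -E memF2 in lF.
  have [k kF] := tab_entry t bS.
  have [_ H] := down _ _ _ _ _ ij ii jj kF.
  have [E'|ne] := eqVneq (i', j') (i, j).
    by apply/imfsetP; exists (i, j, l) => //=; rewrite memF2 -E'.
  apply/imfsetP; exists (i, j, (k - n.*2)%N) => //=; rewrite memF2 subnK//.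
  by have := H _ lF ne; lia.
have memmu b : b \in SD mu <-> exists2 k, (b, k) \in F & (k < n.*2)%N.
  rewrite Emu; split=> [/imfsetP[[c k] /=]|[k kF kn]].
    by rewrite memF1 => /andP[kF kn] ->; exists k.
  by apply/imfsetP; exists (b, k) => //=; rewrite memF1 kF.
have memnu b : b \in SD nu <-> b \in SD lam /\ forall k, (b, k) \in F -> (k < n.*2)%N.
  rewrite Enu in_fsetD; split=> [/andP[nb ->]|[-> H]].
    split=> // k kF; rewrite ltnNge; apply: contra nb => kn.
    by apply/imfsetP; exists (b, (k - n.*2)%N) => //=; rewrite memF2 subnK.
  rewrite andbT; apply/imfsetP => -[[c k] /=]; rewrite memF2 => kF E.
  by move: kF; rewrite -E => /H; lia.
exists mu, nu, F1, F2; split=> //.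
- split.
  + by apply/psubP => b /memmu[k kF _]; exact: (tab_SD t kF).
  + apply/psubP => b /memnu[bS H]; have [k kF] := tab_entry t bS.
    by apply/memmu; exists k => //; exact: H kF.
  + move=> [i j]; rewrite in_fsetD => /andP[bnu bmu]; split=> //.
    have [k kF kn] : exists2 k, (i, j, k) \in F & (n.*2 <= k)%N.
      have [l lF _] := (memmu (i, j)).1 bmu.
      apply: contrapT => H; move/negP: bnu; apply; apply/memnu; split; first exact: (tab_SD t lF).
      by move=> k kF; rewrite ltnNge; apply/negP => kn; apply: H; exists k.
    (* Removing (i, j) leaves an order ideal: another box of [mu] southeast of it would have a small
       entry, yet one at least as large as the large entry [k]. *)
    apply: (@exists_SD mu) => [b|a b a' b' ab aa bb]; rewrite in_fsetD1 => /andP[ne bS] //.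
    rewrite in_fsetD1 (SD_down ab aa bb bS) andbT; apply: contraNneq ne => -[Ei Ej].
    rewrite {}Ei {}Ej in ab aa bb.
    have [l lF ln] := (memmu (a, b)).1 bS.
    have [_ H] := down _ _ _ _ _ ab aa bb lF.
    apply/negPn/negP => ne; have := H _ kF; rewrite eq_sym => /(_ ne); lia.
- split.
  + move=> b; rewrite skewSD0; split=> [/memmu[k kF kn]|[k]]; first by exists k; rewrite memF1 kF.
    by rewrite memF1 => /andP[kF kn]; apply/memmu; exists k.
  + by move=> i j j' k l; rewrite !memF1 => /andP[kF _] /andP[lF _]; exact: R kF lF.
  + by move=> i i' j k l; rewrite !memF1 => /andP[kF _] /andP[lF _]; exact: C kF lF.
  + by move=> d i k; rewrite memF1 => /andP[kF _]; exact: D kF.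
- split.
  + move=> b; rewrite in_fsetD; split=> [/andP[bnu bS]|[k]].
      apply: contrapT => H; move/negP: bnu; apply; apply/memnu; split=> // k kF.
      rewrite ltnNge; apply/negP => kn; apply: H; exists (k - n.*2)%N.
      by rewrite memF2 subnK.
    rewrite memF2 => kF; rewrite (tab_SD t kF) andbT; apply/negP => /memnu[_ /(_ _ kF)]; lia.
  + move=> i j j' k l; rewrite !memF2 => kF lF /(R _ _ _ _ _ kF lF); lia.
  + move=> i j j' k l; rewrite !memF2 => kF lF /(C _ _ _ _ _ kF lF); lia.
  + move=> d i k; rewrite memF2 => /(D d); lia.
- apply/fsetP => -[b k]; rewrite mem_glue// memF1 memF2; case: ltnP => kn.
    by rewrite andbT.
  by rewrite subnK.
Qed.

End Glue.

(** * Coefficients as tableau counts *)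

Lemma coef_prod_fps_var (I : choiceType) (s : seq I) m :
  (\prod_(i <- s) fps_var Zbeta i) m = (m == seq_mset s)%:R.
Proof.
elim: s m => [|x s IH] m.
  rewrite big_nil coef_fps1; congr (_ == _)%:R.
  by apply/msetP => y; rewrite mset_seqE mset0E.
rewrite big_cons coef_splits seq_mset_cons.
pose w := seq_mset s.
rewrite (eq_bigr (fun p => (p.1 == [mset x]%mset)%:R * (p.2 == w)%:R)); last first.
  by move=> p _; rewrite IH [fps_var]unlock.
have [->|ne] := eqVneq m; last first.
  rewrite big_seq big1// => -[a b]; rewrite mem_splits /= => /eqP E.
  case: eqP => [Ea|]; last by rewrite mul0r.
  case: eqP => [Eb|]; last by rewrite mulr0.
  by move: ne; rewrite -E Ea Eb eqxx.
rewrite (bigD1_seq ([mset x]%mset, w)) ?splits_uniq//=; last by rewrite mem_splits /=.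
rewrite !eqxx mulr1 big1 ?addr0// => -[a b]; rewrite xpair_eqE /=.
by case: eqP => _; case: eqP => _ //=; rewrite ?mul0r ?mulr0.
Qed.

Section Cells.
Variables lam mu : spart.
Implicit Type T : filling lam mu.

Definition cell_seq T : seq (box * nat) :=
  [seq (val b, k) | b <- enum {: skewSD lam mu}, k <- enum_fset (T b)].

Definition cells_of T : cells := [fset p in cell_seq T]%fset.

Lemma cell_seq_uniq T : uniq (cell_seq T).
Proof.
apply: allpairs_uniq_dep; first exact: enum_uniq.
  by move=> b _; exact: fset_uniq.
by move=> [b k] [b' k'] /= ? ? [/val_inj E1 E2]; rewrite E1 E2.
Qed.

Lemma cells_ofP T c k : reflect (exists2 b, c = val b & k \in T b) ((c, k) \in cells_of T).
Proof.
apply: (iffP idP) => [|[b -> kT]]; rewrite inE /=.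
  by case/allpairsPdep => b [l [_ lT [-> ->]]]; exists b.
by apply/allpairsPdep; exists b, k; rewrite mem_enum.
Qed.

Lemma mem_cells_of T b k : ((val b, k) \in cells_of T) = (k \in T b).
Proof. by apply/cells_ofP/idP => [[b' /val_inj -> //]|]; exists b. Qed.

Lemma perm_cells_of T : perm_eq (cells_of T) (cell_seq T).
Proof.
apply: uniq_perm; [exact: fset_uniq|exact: cell_seq_uniq|].
by move=> p; rewrite inE.
Qed.

Lemma coef_xmon T m : xmon T m = (m == wt (cells_of T))%:R.
Proof.
rewrite /wt; have /eq_seq_msetP -> := perm_map (fun p => p.2./2) (perm_cells_of T).
rewrite -coef_prod_fps_var big_map /cell_seq big_allpairs_dep /xmon /= big_enum /=.
by [].
Qed.

Lemma tsize_cells_of T : Defs.tsize T = #|` cells_of T|.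
Proof.
rewrite (perm_size (perm_cells_of T)) size_allpairs_dep sumnE big_map big_enum.
by [].
Qed.

(** The conditions on repeated entries are symmetric in the two boxes, so [is_tab] may impose them
    on boxes in increasing order only. *)
Lemma cells_of_bij (dg : bool) :
  set_bij (if dg then @SetShYT_P lam mu else @SetShYT_Q lam mu)
          [set F | is_tab dg lam mu F] cells_of.
Proof.
have inj : injective cells_of.
  move=> T T' E; apply/ffunP => b; apply/fsetP => k.
  by rewrite -!mem_cells_of E.
pose cells_to (F : cells) : filling lam mu :=
  [ffun b : skewSD lam mu => [fset p.2 | p in F & p.1 == val b]%fset].
have cells_toP F b k : (k \in cells_to F b) = ((val b, k) \in F).
  rewrite ffunE; apply/imfsetP/idP => [[[c l] /=]|kF].
    by rewrite inE /= => /andP[lF /eqP <-] ->.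
  by exists (val b, k) => //; rewrite inE /= kF eqxx.
have toK F : is_tab dg lam mu F -> cells_of (cells_to F) = F.
  move=> [S _ _ _]; apply/fsetP => -[c k]; apply/cells_ofP/idP => [[b ->]|kF].
    by rewrite cells_toP.
  have cS : c \in skewSD lam mu by apply/S; exists k.
  by exists (FSetSub cS) => //; rewrite cells_toP.
have tabP T : SetShYT_Q T /\
    (dg -> forall b k, Defs.row b = Defs.col b -> k \in T b -> ~~ primed k) <->
    is_tab dg lam mu (cells_of T).
  split=> [[[N R C CP RP] D]|[S R C D]].
    split.
    - move=> c; split=> [cS|[k /cells_ofP[b -> _]]]; last exact: valP.
      have /fset0Pn[k kT] := N (FSetSub cS).
      by exists k; rewrite -[c]/(val (FSetSub cS)) mem_cells_of.
    - move=> i j j' k l /cells_ofP[b Eb kT] /cells_ofP[b' Eb' lT] jj.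
      have rb : Defs.row b = Defs.row b' by rewrite /Defs.row -Eb -Eb'.
      split; first by apply: (R _ _ rb _ _ _ kT lT); rewrite /Defs.col -Eb -Eb'.
      move=> E; rewrite -E in lT; rewrite -[odd k]negbK; apply: (RP b b') => //.
      by apply/eqP => E'; move: Eb'; rewrite -E' -Eb => -[] E''; lia.
    - move=> i i' j k l /cells_ofP[b Eb kT] /cells_ofP[b' Eb' lT] ii.
      have cb : Defs.col b = Defs.col b' by rewrite /Defs.col -Eb -Eb'.
      split; first by apply: (C _ _ cb _ _ _ kT lT); rewrite /Defs.row -Eb -Eb'.
      move=> E; rewrite -E in lT; apply: (CP b b') => //.
      by apply/eqP => E'; move: Eb'; rewrite -E' -Eb => -[] E''; lia.
    - move=> d i k /cells_ofP[b Eb kT]; rewrite -[odd k]negbK; apply: (D d b) => //.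
      by rewrite /Defs.row /Defs.col -Eb.
  have mem b k : k \in T b -> (Defs.row b, Defs.col b, k) \in cells_of T.
    by rewrite /Defs.row /Defs.col -surjective_pairing mem_cells_of.
  have rc_inj b c : Defs.row b = Defs.row c -> Defs.col b = Defs.col c -> b = c.
    rewrite /Defs.row /Defs.col => E1 E2; apply: val_inj.
    by rewrite [LHS]surjective_pairing E1 E2 -surjective_pairing.
  split; [split|].
  - move=> b; have [k] := (S (val b)).1 (valP b).
    by rewrite mem_cells_of => kT; apply/fset0Pn; exists k.
  - move=> b c E lt k l /mem kF /mem; rewrite -E => lF.
    by case: (R _ _ _ _ _ kF lF lt).
  - move=> b c E lt k l /mem kF /mem; rewrite -E => lF.
    by case: (C _ _ _ _ _ kF lF lt).
  - move=> b c k ne E /mem kF /mem; rewrite -E => lF.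
    have [lt|lt|E'] := ltngtP (Defs.row b) (Defs.row c).
    + by have [_ /(_ erefl)] := C _ _ _ _ _ kF lF lt.
    + by have [_ /(_ erefl)] := C _ _ _ _ _ lF kF lt.
    + by move: ne; rewrite (rc_inj _ _ _ _ E' E) eqxx.
  - move=> b c k ne E /mem kF /mem; rewrite -E => lF; rewrite negbK.
    have [lt|lt|E'] := ltngtP (Defs.col b) (Defs.col c).
    + by have [_ /(_ erefl)] := R _ _ _ _ _ kF lF lt.
    + by have [_ /(_ erefl)] := R _ _ _ _ _ lF kF lt.
    + by move: ne; rewrite (rc_inj _ _ _ _ E E') eqxx.
  - move=> d b k E /mem; rewrite -E negbK; exact: D.
have shP T : (if dg then @SetShYT_P lam mu else @SetShYT_Q lam mu) T <->
    is_tab dg lam mu (cells_of T).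
  apply: iff_trans (tabP T); case: (dg) => /=.
    by split=> [[Q D]|[Q /(_ isT) D]]; split.
  by split=> [Q|[]//]; split.
split.
- by move=> T /shP.
- by move=> T T' _ _; exact: inj.
- by move=> F /= tF; exists (cells_to F); rewrite ?toK//; apply/shP; rewrite toK.
Qed.

End Cells.

Section Counting.
Variable dg : bool.
Implicit Types (lam mu nu : spart) (m : monom nat).

Definition Gskew lam mu : fps Zbeta nat :=
  tableau_gf (if dg then @SetShYT_P lam mu else @SetShYT_Q lam mu).

Lemma finite_tabs lam mu m : finite_set [set F | is_tab dg lam mu F /\ wt F = m].
Proof.
pose U : cells := [fset p in [seq (b, k) | b <- enum_fset (SD lam),
  k <- flatten [seq [:: i.*2; i.*2.+1] | i <- m]]]%fset.
apply: (@sub_finite_set _ _ [set` fpowerset U]); last exact: finite_fset.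
move=> F /= [[S _ _ _] Fm]; rewrite fpowersetE; apply/fsubsetP => -[b k] kF.
rewrite inE /=; apply/allpairsP; exists (b, k); split=> //=.
  have : b \in skewSD lam mu by apply/S; exists k.
  by rewrite in_fsetD => /andP[].
apply/flatten_mapP; exists k./2; first by rewrite -Fm; exact: mem_wt kF.
by rewrite !inE; lia.
Qed.

Definition tabs lam mu m : {fset cells} := fset_set [set F | is_tab dg lam mu F /\ wt F = m].

Lemma tabsP lam mu m F : reflect (is_tab dg lam mu F /\ wt F = m) (F \in tabs lam mu m).
Proof.
rewrite in_fset_set; last exact: finite_tabs.
by apply: (iffP idP) => [/set_mem|?]; rewrite ?inE.
Qed.

(** All tableaux of weight [m] have [size m] entries, hence carry the same power of beta. *)
Lemma coef_Gskew lam mu m : psub mu lam ->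
  Gskew lam mu m = 'X^(size m - #|` skewSD lam mu|) *+ #|` tabs lam mu m|.
Proof.
move=> ml; rewrite /Gskew /tableau_gf asboolT// /fps_sum.
pose f (F : cells) : Zbeta := 'X^(#|` F| - #|` skewSD lam mu|) * (m == wt F)%:R.
transitivity (\sum_(F \in [set F | is_tab dg lam mu F]) f F).
  rewrite (reindex_fsbig _ _ _ f (cells_of_bij lam mu dg)).
  by apply: eq_fsbigr => T _; rewrite coef_constXM coef_xmon tsize_cells_of.
rewrite -(@fsbig_widen _ _ _ _ [set F | is_tab dg lam mu F /\ wt F = m]); last 2 first.
- by move=> F /= [].
- move=> F /= [tF nF]; rewrite /f; case: eqP => [E|]; last by rewrite mulr0.
  by case: nF.
rewrite fsbig_finite; last exact: finite_tabs.
rewrite -/(tabs lam mu m) big_seq (eq_bigr (fun=> 'X^(size m - #|` skewSD lam mu|))).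
  by rewrite -big_seq big_const_seq count_predT iter_addr_0.
by move=> F /tabsP[_ Fm]; rewrite /f -Fm eqxx mulr1 size_wt.
Qed.

(** Every box has an entry. Thus the exponent in [coef_Gskew] is not truncated when a tableau
    exists. *)
Lemma card_tab lam mu F : is_tab dg lam mu F -> (#|` skewSD lam mu| <= #|` F|)%N.
Proof.
move=> [S _ _ _]; have -> : skewSD lam mu = [fset p.1 | p in F]%fset.
  apply/fsetP => b; apply/idP/imfsetP => [/S[k kF]|[[c k] kF ->]]; first by exists (b, k).
  by apply/S; exists k.
exact: leq_trans (leq_imfset_card _ _ _) _.
Qed.

Lemma card_skewSD lam mu : psub mu lam -> (#|` skewSD lam mu| + psize mu)%N = psize lam.
Proof.
move=> /psubP ml; rewrite -!card_SD -(cardfsID (SD mu) (SD lam)) addnC; congr addn.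
by congr #|` _|; apply/esym/fsetIidPr/fsubsetP.
Qed.

Lemma Gskew_degree lam mu m : Gskew lam mu m != 0 -> (psize lam <= size m + psize mu)%N.
Proof.
move=> n0; have ml : psub mu lam.
  apply: contrapT => ml; move: n0; rewrite /Gskew /tableau_gf asboolF//.
  by rewrite coef_fps0 eqxx.
move: n0; rewrite coef_Gskew// => n0; have /fset0Pn[F /tabsP[tF Fm]] : tabs lam mu m != fset0.
  by apply: contraNneq n0 => ->; rewrite cardfs0.
by rewrite -(card_skewSD ml) leq_add2r -Fm size_wt; exact: card_tab tF.
Qed.

End Counting.

Lemma shiftm_inj n (a b a' b' : monom nat) :
  all (fun i => i < n)%N a -> all (fun i => i < n)%N a' ->
  (a `+` shiftm n b)%mset = (a' `+` shiftm n b')%mset -> a = a' /\ b = b'.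
Proof.
move=> /allP an /allP an' /msetP E.
have out (c : monom nat) i : {in c, forall i, i < n}%N -> (n <= i)%N -> c i = 0%N.
  by move=> H ni; apply/eqP; rewrite mset_eq0; apply/negP => /H; lia.
split; apply/msetP => i.
  have [ni|ni] := ltnP i n; last by rewrite (out a _ an) ?(out a' _ an').
  move: (E i); rewrite !msetE2 /shiftm !mmapN ?addn0//; move=> x; lia.
move: (E (n + i)%N); rewrite !msetE2 /shiftm !mmapE; try exact: addnI.
by rewrite (out a _ an) ?(out a' _ an') ?leq_addr.
Qed.

(** * Coproduct *)

Section Coproduct.
Variable dg : bool.
Local Notation tabs := (tabs dg).
Local Notation Gskew := (Gskew dg).

Definition gpairs lam : seq (spart * spart) :=
  [seq p <- [seq (mu, nu) | mu <- enum_fset (pfin (psize lam)), nu <- enum_fset (pfin (psize lam))]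
  | `[< good_pair lam p.1 p.2 >]].

Lemma mem_gpairs lam mu nu : ((mu, nu) \in gpairs lam) = `[< good_pair lam mu nu >].
Proof.
rewrite mem_filter /=; case: asboolP => //= -[ml nm _].
apply/allpairsP; exists (mu, nu); split=> //=; rewrite mem_pfin psize_psub//.
by move=> i; exact: leq_trans (nm i) (ml i).
Qed.

Lemma gpairs_uniq lam : uniq (gpairs lam).
Proof.
apply/filter_uniq/allpairs_uniq; rewrite ?fset_uniq//.
by move=> [a b] [a' b'] _ _ [-> ->].
Qed.

Lemma small_tab n lam mu (m : monom nat) F :
  all (fun i => i < n)%N m -> F \in tabs lam mu m -> small n F.
Proof.
move=> /allP mn /tabsP[_ Fm] b k kF.
have /mn : k./2 \in m by rewrite -Fm; exact: mem_wt kF.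
by lia.
Qed.

(** Gluing is a bijection from the quadruples (mu, nu, F1, F2) onto the tableaux of shape [lam]:
    [split_tab] gives surjectivity, [glue_tab] the target. *)
Lemma card_tabs_coproduct n lam (m1 m2 : monom nat) : all (fun i => i < n)%N m1 ->
  #|` tabs lam spart0 (m1 `+` shiftm n m2)%mset| =
  (\sum_(p <- gpairs lam) #|` tabs p.1 spart0 m1| * #|` tabs lam p.2 m2|)%N.
Proof.
move=> m1n; set m := (m1 `+` _)%mset.
pose pairs (p : spart * spart) : seq (cells * cells) :=
  [seq (F1, F2) | F1 <- enum_fset (tabs p.1 spart0 m1), F2 <- enum_fset (tabs lam p.2 m2)].
pose quads := [seq (p, f) | p <- gpairs lam, f <- pairs p].
pose gl (q : (spart * spart) * (cells * cells)) := glue n q.2.1 q.2.2.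
have quadsP mu nu F1 F2 : ((mu, nu), (F1, F2)) \in quads <->
    [/\ good_pair lam mu nu, is_tab dg mu spart0 F1 /\ wt F1 = m1, small n F1 &
        is_tab dg lam nu F2 /\ wt F2 = m2].
  split=> [/allpairsPdep[[mu' nu'] [[F1' F2'] [+ + [-> -> -> ->]]]]|[gd t1 _ t2]].
    rewrite mem_gpairs => /asboolP gd /allpairsP[[F F'] [/= i1 i2 [-> ->]]].
    by split=> //; [exact/tabsP|exact: small_tab i1|exact/tabsP].
  apply/allpairsPdep; exists (mu, nu), (F1, F2); split=> //.
    by rewrite mem_gpairs; apply/asboolP.
  by apply/allpairsP; exists (F1, F2); split=> //; exact/tabsP.
have -> : (\sum_(p <- gpairs lam) #|` tabs p.1 spart0 m1| * #|` tabs lam p.2 m2|)%N = size quads.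
  rewrite size_allpairs_dep sumnE big_map; apply: eq_bigr => p _.
  by rewrite size_allpairs.
rewrite -(size_map gl); apply: perm_size; apply: uniq_perm.
- exact: fset_uniq.
- rewrite map_inj_in_uniq.
    apply: allpairs_uniq_dep; first exact: gpairs_uniq.
      move=> p _; apply: allpairs_uniq; rewrite ?fset_uniq//.
      by move=> [a b] [a' b'] _ _ [-> ->].
    by move=> [p f] [p' f'] /= ? ? [E1 E2]; rewrite E1 E2.
  move=> [[mu nu] [F1 F2]] [[mu' nu'] [F1' F2']].
  move=> /quadsP[gd [t1 _] s1 [[S2 _ _ _] _]] /quadsP[gd' [t1' _] s1' [[S2' _ _ _] _]].
  rewrite /gl /= => /(glue_inj s1 s1')[E1 E2]; subst F1' F2'.
  (* [mu] is the set of boxes of [F1], and [lam] minus [nu] is that of [F2]; as [nu] lies inside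
     [lam], both are determined. *)
  congr ((_, _), _).
    apply: SD_inj; apply/fsetP => b.
    apply/idP/idP => [/(tab_entry t1)|/(tab_entry t1')] [k kF];
      by [exact: (tab_SD t1' kF)|exact: (tab_SD t1 kF)].
  apply: SD_inj; apply/fsetP => b.
  have sub mu1 nu1 : good_pair lam mu1 nu1 -> b \in SD nu1 -> b \in SD lam.
    by move=> [ml nm _] /((psubP _ _).1 nm)/((psubP _ _).1 ml).
  have skew : (b \in skewSD lam nu) = (b \in skewSD lam nu').
    by apply/idP/idP => [/S2/S2'|/S2'/S2].
  have [bl|/negP bl] := boolP (b \in SD lam); last first.
    by apply/idP/idP => [/(sub _ _ gd)|/(sub _ _ gd')].
  by move: skew; rewrite !in_fsetD bl !andbT; exact: negb_inj.
- move=> F; apply/tabsP/mapP => [[tF Fm]|[[[mu nu] [F1 F2]] /quadsP[gd [t1 w1] s1 [t2 w2]] ->]].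
    have [mu [nu [F1 [F2 [gd s1 t1 t2 EF]]]]] := split_tab n tF.
    move: Fm; rewrite EF wt_glue// => /shiftm_inj[|//|w1 w2].
      apply/allP => x; rewrite (perm_mem (perm_eq_seq_mset _)) => /mapP[[b k] /s1 kn ->] /=.
      by lia.
    by exists ((mu, nu), (F1, F2)) => //; apply/quadsP.
  rewrite /gl /=; split; first exact: glue_tab t1 t2.
  by rewrite wt_glue// w1 w2.
Qed.

Lemma coef_dskew lam mu m : dskew Gskew lam mu m =
  \sum_(nu <- pfin (psize lam) | `[< good_pair lam mu nu >])
    'X^(#|` skewSD mu nu|) * Gskew lam nu m.
Proof.
rewrite /dskew; case: asboolP => [ml|ml]; last first.
  by rewrite coef_fps0 big1// => nu /asboolP[].
rewrite /fps_sum [RHS]bigfs; first last.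
- move=> nu /asboolP[_ nm _]; rewrite mem_pfin => /negP[].
  exact: leq_trans (psize_psub nm) (psize_psub ml).
- exact: fset_uniq.
rewrite (_ : [set` _] = [set nu | psub nu mu /\ forall b, b \in skewSD mu nu -> removable mu b]).
  by apply: eq_fsbigr => nu _; rewrite coef_constXM.
apply/seteqP; split=> nu /=; rewrite unfold_in /=; first by move=> /asboolP[].
by case=> nm H; apply/asboolP.
Qed.

Lemma Gskew_coproduct n lam (m1 m2 : monom nat) : all (fun i => i < n)%N m1 ->
  Gskew lam spart0 (m1 `+` shiftm n m2)%mset =
  \sum_(mu <- pfin (size m1)) Gskew mu spart0 m1 * dskew Gskew lam mu m2.
Proof.
move=> m1n; rewrite coef_Gskew; last exact: psub0.
rewrite (card_tabs_coproduct lam m2 m1n) -sumrMnr size_mset_add size_mmap skewSD0 card_SD.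
transitivity (\sum_(mu <- pfin (psize lam)) Gskew mu spart0 m1 * dskew Gskew lam mu m2); last first.
  rewrite -!fsum_pfin// => mu n0.
    have /Gskew_degree : Gskew mu spart0 m1 != 0 by apply: contraNneq n0 => ->; rewrite mul0r.
    by rewrite addn0.
  have /(dskew_neq0 (@Gskew_degree dg))[/psize_psub //] : dskew Gskew lam mu m2 != 0.
  by apply: contraNneq n0 => ->; rewrite mulr0.
rewrite /gpairs big_filter big_mkcond big_allpairs; apply: eq_bigr => mu _.
rewrite coef_dskew mulr_sumr [RHS]big_mkcond; apply: eq_bigr => nu _ /=.
case: asboolP => // -[ml nm _].
have nl : psub nu lam by move=> i; exact: leq_trans (nm i) (ml i).
rewrite !coef_Gskew//; last exact: psub0.
rewrite skewSD0 card_SD.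
(* The exponents are compared only when both kinds of tableaux exist, where no subtraction is
   truncated; otherwise both sides vanish. *)
have [->|/fset0Pn[F1 /tabsP[t1 w1]]] := eqVneq (tabs mu spart0 m1) fset0.
  by rewrite cardfs0 mul0n !mulr0n mul0r.
have [->|/fset0Pn[F2 /tabsP[t2 w2]]] := eqVneq (tabs lam nu m2) fset0.
  by rewrite cardfs0 muln0 !mulr0n !mulr0.
have := card_tab t1; rewrite skewSD0 card_SD -size_wt w1 => le1.
have := card_tab t2; rewrite -size_wt w2 => le2.
rewrite !mulrnAr mulrnAl -mulrnA mulnC -!exprD; congr ('X^_ *+ (_ * _)).
(* Here [x] is |mu/nu| and [y] is |lam/nu|. Boxes of mu/nu are subtracted in both tableaux, and the
   power of beta in [dskew] restores them. *)
have aux (s1 s2 l u v x y : nat) : (x + v = u -> y + v = l -> u <= s1 -> y <= s2 ->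
  s1 + s2 - l = s1 - u + (x + (s2 - y)))%N by lia.
exact: aux (card_skewSD nm) (card_skewSD nl) le1 le2.
Qed.

End Coproduct.

(** * Linear independence *)

Section Independence.
Variable dg : bool.
Local Notation tabs := (tabs dg).
Local Notation Gskew := (Gskew dg).

(* Row i holds the unprimed number i, whose code is 2 (i - 1) + 1. *)
Definition row_cell (b : box) : box * nat := (b, (b.1.-1).*2.+1).

Definition row_tab mu : cells := [fset row_cell b | b in SD mu]%fset.

(** Equals sum_i i mu_i; it orders the triangular system behind independence. *)
Definition row_sum mu : nat := (\sum_(b <- SD mu) b.1)%N.

Lemma row_cell_inj : injective row_cell.
Proof. by move=> b b' [-> _]. Qed.

Lemma mem_row_tab mu i j k : (i, j, k) \in row_tab mu <-> (i, j) \in SD mu /\ k = (i.-1).*2.+1.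
Proof.
rewrite /row_tab; split=> [/imfsetP[[i' j'] /= bS [-> -> ->]]|[bS ->]] //.
by apply/imfsetP; exists (i, j).
Qed.

Lemma row_tabP mu : is_tab dg mu spart0 (row_tab mu).
Proof.
split.
- move=> [i j]; rewrite skewSD0; split=> [bS|[k /mem_row_tab[]//]].
  by exists (i.-1).*2.+1; apply/mem_row_tab.
- by move=> i j j' k l /mem_row_tab[_ ->] /mem_row_tab[_ ->] _; split=> //; lia.
- move=> i i' j k l /mem_row_tab[+ ->] /mem_row_tab[_ ->] ii; rewrite in_SD; lia.
- by move=> _ i k /mem_row_tab[_ ->]; lia.
Qed.

Lemma sum_row_tab mu (f : nat -> nat) :
  (\sum_(p <- row_tab mu) f p.2./2 = \sum_(b <- SD mu) f b.1.-1)%N.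
Proof.
rewrite big_imfset /=; last by move=> b b' _ _; exact: row_cell_inj.
by apply: eq_bigr => b _; congr f; lia.
Qed.

Lemma sum_wt F F' (f : nat -> nat) : wt F = wt F' ->
  (\sum_(p <- F) f p.2./2 = \sum_(p <- F') f p.2./2)%N.
Proof.
move=> /eq_seq_msetP E; rewrite -!(big_map (fun p : box * nat => p.2./2) xpredT f).
exact: perm_big.
Qed.

Lemma part_count lam i : (0 < i)%N -> part lam i = (\sum_(b <- SD lam) (b.1.-1 == i.-1))%N.
Proof.
move=> i0; transitivity (count (fun b : box => b.1.-1 == i.-1) (SD lam)); last first.
  by rewrite -sum1_count big_mkcond; apply: eq_bigr => b _; case: eqP.
have : perm_eq [seq b <- SD lam | b.1.-1 == i.-1] [seq (i, j) | j <- iota i (part lam i)].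
  apply: uniq_perm; first exact/filter_uniq/fset_uniq.
    by rewrite map_inj_uniq ?iota_uniq// => ? ? [].
  move=> [i' j]; rewrite mem_filter in_SD /=; apply/idP/mapP => [H|[j' + [-> ->]]].
    have Ei : i' = i by lia.
    by exists j; rewrite ?Ei// mem_iota; rewrite Ei in H; lia.
  by rewrite mem_iota; lia.
by move/perm_size; rewrite size_map size_iota size_filter.
Qed.

Lemma eq_sum_leq (T : eqType) (s : seq T) (f g : T -> nat) :
  {in s, forall x, (f x <= g x)%N} -> (\sum_(x <- s) g x <= \sum_(x <- s) f x)%N ->
  {in s, f =1 g}.
Proof.
move=> fg le x xs; apply/eqP; rewrite eqn_leq fg//=.
move: le; rewrite (big_rem x xs) [leqRHS](big_rem x xs) /=.
have : (\sum_(y <- rem x s) f y <= \sum_(y <- rem x s) g y)%N.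
  by rewrite big_seq [leqRHS]big_seq; apply: leq_sum => y /mem_rem/fg.
lia.
Qed.

(** The absolute values of the entries of [F] sum to [row_sum mu]. By [tab_row_le] this is at least
    the sum of their row numbers, which is at least [row_sum lam] since no box is empty. Equality
    forces one entry per box, equal to its row number up to a prime, so the weight is x^lam. *)
Lemma tab_row_tab lam mu F : is_tab dg lam spart0 F -> wt F = wt (row_tab mu) ->
  (row_sum lam < row_sum mu)%N \/ lam = mu.
Proof.
move=> tF EF; have [lt|ge] := ltnP (row_sum lam) (row_sum mu); [by left|right].
pose ch b := if pselect (exists k, (b, k) \in F) is left e then projT1 (cid e) else 0%N.
have chP b : b \in SD lam -> (b, ch b) \in F.
  move=> /(tab_entry tF) e; rewrite /ch; case: pselect => // e'.
  exact: (projT2 (cid e')).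
(* One entry is chosen in each box; any further entry would add a positive row number and exceed the
   bound [le2]. *)
pose F' : cells := [fset (b, ch b) | b in SD lam]%fset.
have F'F : (F' `<=` F)%fset.
  by apply/fsubsetP => _ /imfsetP[b /= bS ->]; exact: chP.
have sumF' (f : box -> nat) : (\sum_(p <- F') f p.1 = \sum_(b <- SD lam) f b)%N.
  by rewrite big_imfset //= => b b' _ _ [].
have le1 : {in F, forall p, (p.1.1 <= p.2./2.+1)%N}.
  by move=> [[i j] k] /= /(tab_row_le tF).
have wmu : (\sum_(p <- F) p.2./2.+1 = row_sum mu)%N.
  rewrite (sum_wt succn EF) sum_row_tab /row_sum big_seq [RHS]big_seq.
  by apply: eq_bigr => -[i j]; rewrite in_SD /=; lia.
have pos : {in F, forall p, (0 < p.1.1)%N}.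
  by move=> [[i j] k] /(tab_SD tF); rewrite in_SD /=; lia.
have split_F (f : box * nat -> nat) :
    (\sum_(p <- F) f p = \sum_(p <- F') f p + \sum_(p <- (F `\` F')%fset) f p)%N.
  rewrite -big_cat; apply: perm_big; apply: uniq_perm; first exact: fset_uniq.
    rewrite cat_uniq !fset_uniq andbT; apply/hasPn => p.
    by rewrite in_fsetD => /andP[].
  move=> p; rewrite mem_cat in_fsetD; case: (boolP (p \in F')) => //= pF'.
  exact: (fsubsetP F'F).
have le2 : (\sum_(p <- F) p.1.1 <= row_sum mu)%N.
  by rewrite -wmu big_seq [leqRHS]big_seq; apply: leq_sum.
have sF' : (\sum_(p <- F') p.1.1)%N = row_sum lam := sumF' fst.
have EFF' : F = F'.
  apply/eqP; rewrite eqEfsubset F'F andbT; apply/fsubsetP => p pF.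
  apply/negPn/negP => pF'; have pD : p \in (F `\` F')%fset by rewrite in_fsetD pF' pF.
  have /= E := split_F (fun p => p.1.1); move: le2; rewrite {}E sF' (big_rem p pD) /= addnCA addnA.
  move=> /(leq_trans (leq_addr _ _)) /leq_trans/(_ ge).
  by rewrite -[leqRHS]add0n leq_add2r leqNgt (pos _ pF).
have eq_rows : {in F, forall p, p.1.1 = p.2./2.+1}.
  by apply: eq_sum_leq => //; rewrite wmu EFF' sF'.
apply: spart_ext => i i0; rewrite !part_count//.
rewrite -(sum_row_tab mu (fun x => x == i.-1 : nat)) -(sum_wt (fun x => x == i.-1 : nat) EF).
rewrite -(sumF' (fun b => b.1.-1 == i.-1 : nat)) -EFF' big_seq [RHS]big_seq.
by apply: eq_bigr => p /eq_rows ->.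
Qed.

Lemma Gskew_independent (C : spart -> Zbeta) :
  (forall m : monom nat, \sum_(mu <- pfin (size m)) Gskew mu spart0 m * C mu = 0) ->
  forall mu, C mu = 0.
Proof.
move=> H mu; have [n] := ubnP (row_sum mu); elim: n mu => // n IH mu; rewrite ltnS => mun.
have szm : size (wt (row_tab mu)) = psize mu.
  by rewrite size_wt card_imfset ?card_SD//; exact: row_cell_inj.
move: (H (wt (row_tab mu))); rewrite (bigD1_seq mu) ?fset_uniq//=; last by rewrite mem_pfin szm.
rewrite big1 ?addr0 => [|lam ne].
  (* The diagonal coefficient is a power of beta times a number of tableaux, in general above 1 for
     GQ. The number is positive because [row_tab mu] is counted, so the coefficient can be cancelled
     in the domain Z[beta]. *)
  rewrite coef_Gskew; last exact: psub0.
  rewrite mulrnAl => /eqP; rewrite -mulrnAr mulf_eq0 expf_eq0 polyX_eq0 andbF /=.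
  rewrite -mulr_natl mulf_eq0 -polyC_natr polyC_eq0 Num.Theory.pnatr_eq0 cardfs_eq0.
  have rmu : row_tab mu \in tabs mu spart0 (wt (row_tab mu)).
    by apply/tabsP; split=> //; exact: row_tabP.
  by case/orP => [/eqP E|/eqP//]; rewrite E in rmu.
have [->|n0] := eqVneq (Gskew lam spart0 (wt (row_tab mu))) 0; first by rewrite mul0r.
move: n0; rewrite coef_Gskew; last exact: psub0.
move=> n0; have /fset0Pn[F /tabsP[tF Fm]] : tabs lam spart0 (wt (row_tab mu)) != fset0.
  by apply: contraNneq n0 => ->; rewrite cardfs0.
case: (tab_row_tab tF Fm) => [lt|E]; last by rewrite E eqxx in ne.
by rewrite IH ?mulr0// (leq_trans lt).
Qed.

End Independence.

Theorem theorem6p10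
    (gp gq : spart -> fps Zbeta nat) (a b : spart -> spart -> spart -> int)
    (Hgp : is_dual GQ gp) (Hgq : is_dual GP gq)
    (Ha : is_structure_constants GP a) (Hb : is_structure_constants GQ b)
    (mu nu : spart) :
  [/\ fps_summable [set: spart]
        (fun lam => in_x (GPdskew lam mu) * in_y (dual_skew a gq lam nu)),
      fps_summable [set: spart]
        (fun kap => in_x (GPdskew nu kap) * in_y (dual_skew a gq mu kap)) &
      fps_sum [set: spart]
        (fun lam => in_x (GPdskew lam mu) * in_y (dual_skew a gq lam nu)) =
      cauchy * fps_sum [set: spart]
        (fun kap => in_x (GPdskew nu kap) * in_y (dual_skew a gq mu kap))] /\
  [/\ fps_summable [set: spart]
        (fun lam => in_x (GQdskew lam mu) * in_y (dual_skew b gp lam nu)),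
      fps_summable [set: spart]
        (fun kap => in_x (GQdskew nu kap) * in_y (dual_skew b gp mu kap)) &
      fps_sum [set: spart]
        (fun lam => in_x (GQdskew lam mu) * in_y (dual_skew b gp lam nu)) =
      cauchy * fps_sum [set: spart]
        (fun kap => in_x (GQdskew nu kap) * in_y (dual_skew b gp mu kap))].
Proof.
split.
- exact: (skew_cauchy (@Gskew_degree true) (@Gskew_coproduct true)
    (@Gskew_independent true) Hgq Ha).
- exact: (skew_cauchy (@Gskew_degree false) (@Gskew_coproduct false)
    (@Gskew_independent false) Hgp Hb).
Qed.
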